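(* (i) Every locally compact abelian group $A$ has a unique chain of closed subgroups $0 \subseteq A_{\mathbb{S}^1} \subseteq F_{\mathbb{Z}} A \subseteq A$ such that $A_{\mathbb{S}^1}$, $A_{\mathbb{A}} := F_{\mathbb{Z}} A/A_{\mathbb{S}^1}$ and $A_{\mathbb{Z}} := A/F_{\mathbb{Z}} A$ are of type $\mathbb{S}^1$, $\mathbb{A}$ and $\mathbb{Z}$, respectively. (ii) $f(A_{\mathbb{S}^1}) \subseteq B_{\mathbb{S}^1}$ and $f(F_{\mathbb{Z}} A) \subseteq F_{\mathbb{Z}} B$ for all continuous homomorphisms $f: A \to B$ of locally compact abelian groups.
   Context: Locally compact abelian (LCA) groups are Hausdorff. An LCA group $A$ is a topological torsion group if $\lim_{n \to \infty} n!\, a = 0$ for all $a \in A$. An LCA group $A$ is of type $\mathbb{Z}$ if it is discrete and torsionfree; of type $\mathbb{S}^1$ if it is compact and connected; of type $\mathbb{A}$ if $A \cong A_{\mathbb{R}} \oplus A_{\mathrm{toptors}}$ with $A_{\mathbb{R}} \cong \mathbb{R}^n$ for some $n$ and $A_{\mathrm{toptors}}$ a topological torsion group. *)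

(* Defs.v *)
From HB Require Import structures.
From mathcomp Require Import all_boot all_order all_algebra.
From mathcomp Require Import all_classical all_reals all_analysis.
From mathcomp Require Import ring_quotient.

Set Implicit Arguments.
Unset Strict Implicit.
Unset Printing Implicit Defensive.

Import GRing.Theory.
Import numFieldNormedType.Exports.

Local Open Scope classical_set_scope.
Local Open Scope ring_scope.

(* The product structure is put on an alias, so as not to compete with the
   library's instances on products of normed modules. *)
Definition prod_group (G H : topologicalZmodType) : Type := (G * H)%type.

Section ProdGroup.
Variables G H : topologicalZmodType.

HB.instance Definition _ := GRing.Zmodule.copy (prod_group G H) (G * H)%type.
HB.instance Definition _ := Topological.copy (prod_group G H) (G * H)%type.

Lemma prod_group_sub_continuous :
  continuous (fun z : prod_group G H * prod_group G H => z.1 - z.2).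
Proof.
move=> z; apply: cvg_pair.
  apply: (@continuous_comp _ _ _
    (fun z : prod_group G H * prod_group G H => (z.1.1, z.2.1))
    (fun x : G * G => x.1 - x.2)); last exact: sub_continuous.
  by apply: cvg_pair; apply: (@continuous_comp _ _ _ _ fst);
    [exact: cvg_fst|exact: cvg_fst|exact: cvg_snd|exact: cvg_fst].
apply: (@continuous_comp _ _ _
  (fun z : prod_group G H * prod_group G H => (z.1.2, z.2.2))
  (fun x : H * H => x.1 - x.2)); last exact: sub_continuous.
by apply: cvg_pair; apply: (@continuous_comp _ _ _ _ snd);
  [exact: cvg_fst|exact: cvg_snd|exact: cvg_snd|exact: cvg_snd].
Qed.

HB.instance Definition _ :=
  PreTopologicalNmodule_isTopologicalZmodule.Build (prod_group G H)
    prod_group_sub_continuous.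
End ProdGroup.

Definition subgroup (G : topologicalZmodType) (S : zmodClosed G) : Type :=
  {x : G | x \in S}.

Section Subgroup.
Variables (G : topologicalZmodType) (S : zmodClosed G).

HB.instance Definition _ := SubType.on (subgroup S).
HB.instance Definition _ := [Choice of subgroup S by <:].
HB.instance Definition _ := [SubChoice_isSubZmodule of subgroup S by <:].
HB.instance Definition _ :=
  Topological.copy (subgroup S) (initial_topology (val : subgroup S -> G)).

Lemma subgroup_val_continuous : continuous (val : subgroup S -> G).
Proof. exact: initial_continuous. Qed.

Lemma subgroup_sub_continuous :
  continuous (fun z : subgroup S * subgroup S => z.1 - z.2).
Proof.
apply: continuous_comp_initial => z.
apply: (@continuous_comp _ _ _
  (fun z : subgroup S * subgroup S => (val z.1, val z.2))
  (fun x : G * G => x.1 - x.2)); last exact: sub_continuous.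
by apply: cvg_pair; apply: continuous_comp; [exact: cvg_fst| |exact: cvg_snd|];
  exact: subgroup_val_continuous.
Qed.

HB.instance Definition _ :=
  PreTopologicalNmodule_isTopologicalZmodule.Build (subgroup S)
    subgroup_sub_continuous.
End Subgroup.

Definition quotient_group (G : topologicalZmodType) (S : zmodClosed G) : Type :=
  quotient_topology (Quotient.quot S).

Section QuotientGroup.
Variables (G : topologicalZmodType) (S : zmodClosed G).

HB.instance Definition _ :=
  Topological.copy (quotient_group S) (quotient_topology (Quotient.quot S)).
(* The group law of [Quotient.quot S], over the [choiceType] structure that
   comes with the quotient topology. *)
HB.instance Definition _ := GRing.isZmodule.Build (quotient_group S)
  (@Quotient.addqA G S) (@Quotient.addqC G S)
  (@Quotient.add0q G S) (@Quotient.addNq G S).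

Local Notation proj := (\pi_(Quotient.quot S)%qT : G -> quotient_group S).

Lemma quotient_group_pi_continuous : continuous proj.
Proof. exact: pi_continuous. Qed.

Lemma quotient_group_piB : {morph proj : x y / x - y}.
Proof. by move=> x y; rewrite /= !piE. Qed.

Lemma quotient_group_piP (x y : G) : proj x = proj y <-> x - y \in S.
Proof. by rewrite Quotient.idealrBE; split=> [h|h]; [apply/eqP|exact: (elimT eqP h)]. Qed.

Lemma quotient_group_pi_open (U : set G) : open U -> open (proj @` U).
Proof.
move=> oU; rewrite /open /= /quotient_open.
rewrite (_ : _ @^-1` _ =
    \bigcup_(s in [set` S]) ((fun x => x - s) @^-1` U)); last first.
  apply/seteqP; split=> [x /= [u Uu /esym /quotient_group_piP xuS]|x [s /= sS Uxs]].
    by exists (x - u) => //=; rewrite opprB addrC subrK.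
  exists (x - s) => //; apply/quotient_group_piP.
  by rewrite addrAC subrr add0r rpredN.
apply: bigcup_open => s _; apply: open_comp => // x _.
apply: (@continuous_comp _ _ _ (fun x => (x, s)) (fun x : G * G => x.1 - x.2));
  last exact: sub_continuous.
by apply: cvg_pair; [exact: cvg_id|exact: cvg_cst].
Qed.

Lemma quotient_group_pi_nbhs (u : G) (U : set G) :
  nbhs u U -> nbhs (proj u) (proj @` U).
Proof.
rewrite nbhsE => -[V [oV Vu] VU].
apply: (@filterS _ _ _ (proj @` V)); first exact: image_subset.
apply: (@open_nbhs_nbhs (quotient_group S)).
split; [exact: quotient_group_pi_open|by exists u].
Qed.

Lemma quotient_group_sub_continuous :
  continuous (fun z : quotient_group S * quotient_group S => z.1 - z.2).
Proof.
move=> [p q].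
have [x <-] : exists x, proj x = p by exists (repr p); exact: reprK.
have [y <-] : exists y, proj y = q by exists (repr q); exact: reprK.
move=> W /=; rewrite -quotient_group_piB => /quotient_group_pi_continuous.
move=> /(@sub_continuous G (x, y)) [[P Q] /= [xP yQ] PQW].
exists (proj @` P, proj @` Q) => /=.
  by split; exact: quotient_group_pi_nbhs.
move=> [_ _] /= [[u Pu <-] [v Qv <-]].
rewrite -quotient_group_piB.
exact: (PQW (u, v)).
Qed.

HB.instance Definition _ :=
  PreTopologicalNmodule_isTopologicalZmodule.Build (quotient_group S)
    quotient_group_sub_continuous.
End QuotientGroup.

(* [S] seen inside [F]; as a subgroup of [F] it is [S `&` F]. *)
Definition subgroup_in (G : topologicalZmodType) (F S : zmodClosed G) :
  {pred subgroup F} := [pred x : subgroup F | val x \in S].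
Arguments subgroup_in {G} F S.

Section SubgroupIn.
Variables (G : topologicalZmodType) (F S : zmodClosed G).

Lemma subgroup_in_zmod_closed : zmod_closed (subgroup_in F S).
Proof.
split=> [|x y]; rewrite /subgroup_in !inE ?raddf0 ?rpred0//.
by rewrite raddfB; exact: rpredB.
Qed.

HB.instance Definition _ :=
  GRing.isZmodClosed.Build (subgroup F) (subgroup_in F S)
    subgroup_in_zmod_closed.
End SubgroupIn.

Definition subquotient (G : topologicalZmodType) (F S : zmodClosed G) :=
  quotient_group (subgroup_in F S).

Definition topgroup_isomorphic (G H : topologicalZmodType) : Prop :=
  exists (f : {additive G -> H}) (g : H -> G),
    [/\ cancel f g, cancel g f, continuous f & continuous g].

Definition LCA (G : topologicalZmodType) : Prop :=
  hausdorff_space G /\ locally_compact [set: G].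

Definition topological_torsion (G : topologicalZmodType) : Prop :=
  LCA G /\ forall a : G, a *+ n`! @[n --> \oo] --> (0 : G).

Definition discrete (G : topologicalZmodType) : Prop :=
  forall U : set G, open U.

Definition torsionfree (G : zmodType) : Prop :=
  forall (a : G) (n : nat), (0 < n)%N -> a *+ n = 0 -> a = 0.

Definition type_Z (G : topologicalZmodType) : Prop :=
  [/\ LCA G, discrete G & torsionfree G].

Definition type_S1 (G : topologicalZmodType) : Prop :=
  [/\ LCA G, compact [set: G] & connected [set: G]].

Definition type_A (R : realType) (G : topologicalZmodType) : Prop :=
  LCA G /\ exists GR Gtt : topologicalZmodType,
    [/\ exists n : nat, topgroup_isomorphic GR 'rV[R]_n,
        topological_torsion Gtt
      & topgroup_isomorphic G (prod_group GR Gtt)].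

(* The chain [0 <= S <= F <= A], with [S] for A_{S^1} and [F] for F_Z A. *)
Definition is_canonical_chain (R : realType) (A : topologicalZmodType)
    (S F : zmodClosed A) : Prop :=
  [/\ closed [set` S] /\ closed [set` F], {subset S <= F},
      type_S1 (subgroup S), type_A R (subquotient F S)
    & type_Z (quotient_group F)].

(* Main.v *)
Require Import Defs.
From HB Require Import structures.
From mathcomp Require Import all_boot all_order all_algebra all_field.
From mathcomp Require Import all_classical all_reals all_analysis.
From mathcomp Require Import ring_quotient zify ring lra.

(** Everything rests on compactness and on integral combinations; neither
    the characters of [A] nor its Haar measure are used.

    Existence. Let [U] be a compact symmetric neighbourhood of [0] in [A]. Since
    finitely many translates of [U] cover [U + U], the open subgroup [G]
    generated by [U] is [U + N] with [N] finitely generated. Multiples of an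
    element either escape to infinity modulo a subgroup or stay at bounded
    distance from it ([relatively_compact_multiples]); adding the generators of
    [N] one at a time, one finds a lattice [Z^k], coarsely embedded in [A], at
    bounded distance from all of [G] ([zspan_coarsely_lattice]). The coordinates
    of a nearby lattice point define a map [q] from [G] to [R^k] that is additive
    up to a bounded error, and the limit of [q (2 ^ n x) / 2 ^ n] is a continuous
    proper homomorphism [phi] ([homogenize], [proper_hom_exists]). When [k] is
    least possible, [phi] is onto ([proper_hom_onto]). Its kernel [C] is compact.

    The lower step [S] of the chain is the intersection of the subgroups [n! C].
    By compactness it is divisible and the [n! C] shrink to it; a compact
    divisible group has no proper open subgroup, hence is connected
    ([compact_divisible_core]). The upper step [F] consists of the elements
    having a multiple [m x], [m > 0], in [G], so that [A / F] is discrete and torsion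
    free. As [R^k] is divisible and torsion free, [phi] extends to [F / S]. The
    extension splits, because [n!] times any lift of [v / n!] converges as [n]
    grows ([real_section]), and its kernel is a topological torsion group since
    [n!] tends to [0] on [C / S] ([split_type_A]).

    Functoriality, and uniqueness as the case of the identity, hold because
    every homomorphism from type S^1 to type A or Z and from type A to type Z
    is zero. The substantial case is that of a connected compact group [X]
    mapping to a topological torsion group. By a Baire argument, [n!] then tends
    to [0] uniformly on the image of [X] ([hom_to_topological_torsion]); this is
    absurd for a nonzero image if [X = n! X]. The divisibility of [X] means that
    a connected compact group [Y] of prime exponent [p] is trivial
    ([connected_compact_exponent]). Finite subgroups of such a group, generated by
    elements as close to [0] as desired, come close to all its points. A
    neighbourhood of [0] has density bounded below in them, so by [bogoliubov]
    sums of four of its translated elements fill a subgroup of bounded index;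
    combinations of a bounded number of the small generators fill the quotient,
    so every point of [Y] is close to [0]. *)

Import Order.TTheory GRing.Theory Num.Theory.
Import numFieldNormedType.Exports.
Local Open Scope ring_scope.

(** * Deciding identities in abelian groups *)

(** Reified abelian-group expressions. Two of them have the same value as soon
    as every atom occurs with the same integer coefficient in both, and this is
    settled by computation. *)
Inductive zexpr := ZVar of nat | ZZero | ZAdd of zexpr & zexpr | ZOpp of zexpr.

Fixpoint zeval {G : zmodType} (env : seq G) (e : zexpr) : G :=
  match e with
  | ZVar i => env`_i
  | ZZero => 0
  | ZAdd a b => zeval env a + zeval env b
  | ZOpp a => - zeval env a
  end.

Fixpoint zcoef (i : nat) (e : zexpr) : int :=
  match e with
  | ZVar j => (i == j)%:Z
  | ZZero => 0
  | ZAdd a b => zcoef i a + zcoef i b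
  | ZOpp a => - zcoef i a
  end.

Lemma zevalE {G : zmodType} (env : seq G) e :
  zeval env e = \sum_(i < size env) env`_i *~ zcoef i e.
Proof.
elim: e => [j||a IHa b IHb|a IHa] /=.
- have [lt|ge] := ltnP j (size env); last first.
    rewrite nth_default // big1 // => i _.
    by rewrite (_ : (i == j :> nat) = false) ?mulr0z //; apply: ltn_eqF; exact: leq_trans ge.
  rewrite (bigD1 (Ordinal lt)) //= eqxx mulr1z big1 ?addr0 // => i ne.
  by rewrite (_ : (i == j :> nat) = false) ?mulr0z //; apply/negbTE.
- by rewrite big1 // => i _; rewrite mulr0z.
- by rewrite IHa IHb -big_split; apply: eq_bigr => i _; rewrite mulrzDr.
- by rewrite IHa -sumrN; apply: eq_bigr => i _; rewrite mulrNz.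
Qed.

Lemma zeval_eq {G : zmodType} (env : seq G) e1 e2 :
  all (fun i => zcoef i e1 == zcoef i e2) (iota 0 (size env)) ->
  zeval env e1 = zeval env e2.
Proof.
move=> /allP h; rewrite !zevalE; apply: eq_bigr => i _.
by rewrite (eqP (h i _)) // mem_iota /=.
Qed.

(* Atoms are compared up to conversion, since the same element may be written
   with different structure instances. *)
Ltac zmod_same x y := constr:(@erefl _ x : x = y).

Ltac zmod_index x env :=
  match env with
  | ?y :: _ => let _ := zmod_same x y in constr:(0%N)
  | _ :: ?env' => let i := zmod_index x env' in constr:(S i)
  end.

Ltac zmod_insert x env :=
  match env with
  | nil => constr:(x :: nil)
  | ?y :: _ => let _ := zmod_same x y in env
  | ?y :: ?env' => let e := zmod_insert x env' in constr:(y :: e)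
  end.

Ltac zmod_atoms t env :=
  lazymatch t with
  | (?a + ?b)%R => let e := zmod_atoms a env in zmod_atoms b e
  | (- ?a)%R => zmod_atoms a env
  | 0%R => env
  | _ => zmod_insert t env
  end.

Ltac zmod_reify t env :=
  lazymatch t with
  | (?a + ?b)%R =>
    let x := zmod_reify a env in let y := zmod_reify b env in constr:(ZAdd x y)
  | (- ?a)%R => let x := zmod_reify a env in constr:(ZOpp x)
  | 0%R => constr:(ZZero)
  | _ => let i := zmod_index t env in constr:(ZVar i)
  end.

Ltac zmod :=
  lazymatch goal with
  | |- @eq ?T ?a ?b =>
    let e0 := zmod_atoms a (@nil T) in let env := zmod_atoms b e0 in
    let x := zmod_reify a env in let y := zmod_reify b env in
    exact (@zeval_eq _ env x y isT)
  end.

(** * Bogoliubov's theorem over a prime field *)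

Section Bogoliubov.
Variables (p n : nat) (w : algC).
Hypotheses (p_pr : prime p) (w_pr : p.-primitive_root w).
Local Notation V := 'rV['F_p]_n.
Implicit Types (a x y z : V) (E : {set V}).

Definition dotrV a x : 'F_p := \sum_i a 0 i * x 0 i.

Definition addchar a x : algC := w ^+ (dotrV a x : nat).

Lemma dotrVDr a x y : dotrV a (x + y) = dotrV a x + dotrV a y.
Proof. by rewrite -big_split; apply: eq_bigr => i _; rewrite mxE mulrDr. Qed.

Lemma dotrVDl a b x : dotrV (a + b) x = dotrV a x + dotrV b x.
Proof. by rewrite -big_split; apply: eq_bigr => i _; rewrite mxE mulrDl. Qed.

Lemma expwD (s t : 'F_p) : w ^+ ((s + t)%R : nat) = w ^+ (s : nat) * w ^+ (t : nat).
Proof.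
rewrite -exprD /= -(prim_expr_mod w_pr) -[in RHS](prim_expr_mod w_pr); congr (w ^+ _).
by rewrite [X in ((_ %% X) %% _)%N](Fp_cast p_pr) modn_mod.
Qed.

Lemma addcharD a x y : addchar a (x + y) = addchar a x * addchar a y.
Proof. by rewrite /addchar dotrVDr expwD. Qed.

Lemma addcharDl a b x : addchar (a + b) x = addchar a x * addchar b x.
Proof. by rewrite /addchar dotrVDl expwD. Qed.

Lemma addchar0 a : addchar a 0 = 1.
Proof.
by rewrite /addchar (_ : dotrV a 0 = 0) ?expr0 // /dotrV big1 // => i _; rewrite mxE mulr0.
Qed.

Lemma normr_addchar a x : `|addchar a x| = 1.
Proof.
have p0 : (0 < p)%N by exact: prime_gt0.
have : `|w| ^+ p == 1 by rewrite -normrX (prim_expr_order w_pr) normr1.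
by rewrite normrX pexpr_eq1 // => /eqP ->; rewrite expr1n.
Qed.

Lemma addcharN a x : addchar a (- x) = (addchar a x)^*.
Proof.
have nz : addchar a x != 0 by rewrite -normr_eq0 normr_addchar oner_eq0.
apply: (mulfI nz); rewrite -addcharD subrr addchar0 -normCK normr_addchar.
by rewrite expr1n.
Qed.

Lemma sum_addchar z : \sum_a addchar a z = if z == 0 then #|{: V}|%:R else 0.
Proof.
case: eqP => [->|/eqP nz].
  by under eq_bigr => a _ do rewrite addchar0; rewrite sumr_const.
have [i zi] : exists i, z 0 i != 0.
  apply/existsP; rewrite -negb_forall; apply: contra nz => /forallP h.
  by apply/eqP/rowP => i; rewrite mxE; apply/eqP.
pose d : V := delta_mx 0 i.
have dz : dotrV d z = z 0 i.
  rewrite /dotrV (bigD1 i) //= mxE !eqxx mul1r big1 ?addr0 // => j ji.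
  by rewrite mxE (negbTE ji) andbF mul0r.
have ne1 : addchar d z != 1.
  rewrite /addchar dz -(prim_order_dvd w_pr) gtnNdvd //.
    by rewrite lt0n; apply: contra zi => /eqP h; apply/eqP/val_inj.
  by have := ltn_ord (z 0 i); rewrite [X in (_ < X)%N](Fp_cast p_pr).
have : \sum_a addchar a z = addchar d z * \sum_a addchar a z.
  rewrite {1}(reindex_inj (addrI d)) mulr_sumr; apply: eq_bigr => a _.
  exact: addcharDl.
move=> /eqP; rewrite -subr_eq0 -{1}[\sum_a _]mul1r -mulrBl mulf_eq0 subr_eq0 eq_sym (negbTE ne1).
by move=> /eqP.
Qed.

Definition fourier E a : algC := \sum_(x in E) addchar a x.

Lemma fourier_parseval E : \sum_a `|fourier E a| ^+ 2 = (#|{: V}| * #|E|)%:R.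
Proof.
under eq_bigr => a _.
  rewrite normCK /fourier raddf_sum big_distrlr /=.
  under eq_bigr => x _ do under eq_bigr => u _ do rewrite -addcharN -addcharD.
  over.
rewrite exchange_big /= natrM mulrC -sum1_card natr_sum mulr_suml.
apply: eq_bigr => x xE; rewrite exchange_big /= (bigD1 x) //= sum_addchar subrr eqxx.
rewrite mul1r big1 ?addr0 // => u /andP [_ ux]; rewrite sum_addchar subr_eq0 eq_sym.
by rewrite (negbTE ux).
Qed.

(** The left-hand side is, up to a factor, the number of ways of writing [z] as
    [x + y - u - v] with terms in [E]. *)
Lemma fourier_convolution E z :
  (forall x y u v, x \in E -> y \in E -> u \in E -> v \in E -> z != x + y - (u + v)) ->
  \sum_a (`|fourier E a| ^+ 2) ^+ 2 * addchar a (- z) = 0.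
Proof.
move=> hz; have expand a : (`|fourier E a| ^+ 2) ^+ 2 * addchar a (- z) =
    \sum_(x in E) \sum_(y in E) \sum_(u in E) \sum_(v in E) addchar a (x + y - (u + v) - z).
  have -> : (`|fourier E a| ^+ 2) ^+ 2 * addchar a (- z) = fourier E a * (fourier E a *
      ((fourier E a)^* * ((fourier E a)^* * addchar a (- z)))).
    by rewrite normCK; ring.
  have fM c : fourier E a * c = \sum_(x in E) addchar a x * c by rewrite mulr_suml.
  have fcM c : (fourier E a)^* * c = \sum_(x in E) (addchar a x)^* * c.
    by rewrite -mulr_suml -raddf_sum.
  rewrite fM; apply: eq_bigr => x _; rewrite fM mulr_sumr; apply: eq_bigr => y _.
  rewrite fcM !mulr_sumr; apply: eq_bigr => u _.
  rewrite fcM !mulr_sumr; apply: eq_bigr => v _.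
  by rewrite -!addcharN -!addcharD opprD !addrA.
under eq_bigr => a _ do rewrite expand.
rewrite exchange_big /=; apply: big1 => x xE.
rewrite exchange_big /=; apply: big1 => y yE.
rewrite exchange_big /=; apply: big1 => u uE.
rewrite exchange_big /=; apply: big1 => v vE.
by rewrite sum_addchar subr_eq0 eq_sym (negbTE (hz _ _ _ _ xE yE uE vE)).
Qed.

(** [K] is the set of the frequencies where the Fourier transform of [E] is
    large; Parseval's identity bounds its size. If [z] is annihilated by [K],
    the large frequencies contribute positively to the number of
    representations of [z], and they outweigh the small ones. *)
Lemma bogoliubov E k : (0 < #|E|)%N -> (#|{: V}| <= k * #|E|)%N ->
  exists K : {set V}, (#|K| <= k ^ 2)%N /\
    forall z, (forall a, a \in K -> dotrV a z = 0) ->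
    exists x y u v, [/\ x \in E, y \in E, u \in E & v \in E] /\ z = x + y - (u + v).
Proof.
move=> E0 hk; pose N := #|{: V}|.
have N0 : (0 < N)%N by apply: leq_trans E0 _; exact: max_card.
pose F a := `|fourier E a| ^+ 2.
have F0 a : 0 <= F a by rewrite exprn_ge0.
pose K := [set a | #|E|%:R ^+ 3 <= N%:R * F a].
have F00 : F 0 = #|E|%:R ^+ 2.
  rewrite /F /fourier (eq_bigr (fun=> 1)) ?sumr_const ?normr_nat // => x _.
  by rewrite /addchar (_ : dotrV 0 x = 0) ?expr0 // /dotrV big1 // => i _; rewrite mxE mul0r.
have K0 : 0 \in K.
  by rewrite inE F00 exprS ler_wpM2r ?exprn_ge0 ?ler0n // ler_nat max_card.
exists K; split.
  have : #|K|%:R * #|E|%:R ^+ 3 <= N%:R * (N * #|E|)%:R :> algC.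
    rewrite -fourier_parseval mulr_sumr -sum1_card natr_sum mulr_suml.
    rewrite [leRHS](bigID (mem K)) /= -[leLHS]addr0; apply: lerD.
      by apply: ler_sum => a; rewrite inE mul1r.
    by apply: sumr_ge0 => a _; apply: mulr_ge0; [exact: ler0n|exact: F0].
  rewrite -natrX -!natrM ler_nat => h.
  have {h} : (#|K| * #|E| ^ 2 <= N ^ 2)%N.
    by rewrite -(leq_pmul2r E0) -mulnA -expnSr -[(N ^ 2)%N]mulnn -mulnA.
  have hN : (N ^ 2 <= k ^ 2 * #|E| ^ 2)%N by rewrite -expnMn leq_exp2r.
  by move=> /leq_trans /(_ hN); rewrite leq_pmul2r // expn_gt0 E0.
move=> z hz; apply: contrapT => nz.
have : \sum_a F a ^+ 2 * addchar a (- z) = 0.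
  apply: fourier_convolution => x y u v xE yE uE vE; apply/eqP => zE.
  by apply: nz; exists x, y, u, v.
rewrite (bigID (mem K)) /= => /eqP; rewrite addr_eq0 => /eqP eqK.
have : `|\sum_(a in K) F a ^+ 2 * addchar a (- z)| <= \sum_(a | a \notin K) F a ^+ 2.
  rewrite eqK normrN; apply: le_trans (ler_norm_sum _ _ _) _.
  by apply: ler_sum => a _; rewrite normrM normr_addchar mulr1 ger0_norm // exprn_ge0.
rewrite (eq_bigr (fun a => F a ^+ 2)); last first.
  by move=> a aK; rewrite addcharN /addchar hz // expr0 conjC1 mulr1.
rewrite ger0_norm; last by apply: sumr_ge0 => a _; rewrite exprn_ge0.
have lo : #|E|%:R ^+ 4 <= \sum_(a in K) F a ^+ 2.
  rewrite (bigD1 0) //= F00 -exprM lerDl.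
  by apply: sumr_ge0 => a _; rewrite exprn_ge0.
have hi : N%:R * (\sum_(a | a \notin K) F a ^+ 2) <=
    #|E|%:R ^+ 3 * \sum_(a | a \notin K) F a.
  rewrite !mulr_sumr; apply: ler_sum => a; rewrite inE.
  rewrite -real_ltNge ?ger0_real ?exprn_ge0 ?mulr_ge0 ?ler0n //.
  by move=> /ltW h; rewrite exprS mulrA expr1 ler_wpM2r.
have tot : \sum_(a | a \notin K) F a < N%:R * #|E|%:R.
  have := fourier_parseval E; rewrite (bigID (mem K)) /= natrM => <-.
  rewrite ltrDr (bigD1 0) //= ltr_pwDl //; last by apply: sumr_ge0 => a _; exact: F0.
  by have := F00; rewrite /F => ->; rewrite exprn_gt0 // ltr0n.
move=> /(le_trans lo); rewrite -(ler_pM2l (x := N%:R)) ?ltr0n // => /le_trans /(_ hi).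
have e3 : 0 < #|E|%:R ^+ 3 :> algC by rewrite exprn_gt0 // ltr0n.
have -> : N%:R * #|E|%:R ^+ 4 = #|E|%:R ^+ 3 * (N%:R * #|E|%:R) :> algC by ring.
by rewrite ler_pM2l // => /le_lt_trans /(_ tot); rewrite ltxx.
Qed.
End Bogoliubov.

Local Open Scope classical_set_scope.
Local Open Scope ring_scope.

(** * Neighbourhoods and compact sets in topological abelian groups *)

Section Basics.
Context {A : topologicalZmodType}.
Implicit Types (U V W K L : set A) (x y : A).

Lemma shift_continuous (a : A) : continuous (fun y : A => a + y).
Proof.
move=> b; apply: (@continuous_comp _ _ _ (fun y : A => (a, y)) (fun p : A * A => p.1 + p.2)).
  by apply: cvg_pair; [exact: cvg_cst|exact: cvg_id].
exact: add_continuous.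
Qed.

Lemma nbhs_shift x U : nbhs x U <-> nbhs (0 : A) [set y | U (x + y)].
Proof.
split=> h.
  by apply: (@shift_continuous x 0 U); rewrite addr0.
have := shift_continuous (- x) x; rewrite /continuous_at addNr => /(_ _ h) h'.
by apply: (@filterS _ (nbhs x) _ _ _ _ h') => y /=; rewrite addrA subrr add0r.
Qed.

Lemma nbhs0_opp V : nbhs (0 : A) V -> nbhs (0 : A) [set x | V (- x)].
Proof.
by move=> V0; have := @opp_continuous A 0; rewrite /continuous_at oppr0 => /(_ _ V0).
Qed.

Lemma nbhs0_half W : nbhs (0 : A) W ->
  exists V, [/\ nbhs (0 : A) V, forall x, V x -> V (- x) &
    forall x y, V x -> V y -> W (x + y)].
Proof.
move=> W0; have := @add_continuous A (0, 0); rewrite /continuous_at /= addr0.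
move=> /(_ _ W0) [[P Q] /= [P0 Q0] PQ].
pose V := P `&` Q; have V0 : nbhs (0 : A) V by exact: filterI.
exists (V `&` [set x | V (- x)]); split.
- by apply: filterI => //; exact: nbhs0_opp.
- by move=> x [Vx VNx]; split; rewrite //= opprK.
- by move=> x y [[Px _] _] [[_ Qy] _]; exact: (PQ (x, y)).
Qed.

(** Sums are indexed by sequences, so that one statement serves every length. *)
Lemma nbhs0_sums n W : nbhs (0 : A) W ->
  exists V, [/\ nbhs (0 : A) V, forall x, V x -> V (- x) &
    forall s : seq A, (size s <= n)%N -> (forall x, x \in s -> V x) ->
      W (\sum_(x <- s) x)].
Proof.
elim: n W => [|n IHn] W W0.
  have [V [V0 VN VW]] := nbhs0_half _ W0; exists V; split=> // -[] // _ _.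
  by rewrite big_nil; exact: nbhs_singleton.
have [V1 [V10 V1N V1W]] := nbhs0_half _ W0.
have [V2 [V20 V2N V2V1]] := IHn _ V10.
exists (V1 `&` V2); split; first exact: filterI.
  by move=> x [? ?]; split; [exact: V1N|exact: V2N].
case=> [|x s] /= sn sV; first by rewrite big_nil; exact: nbhs_singleton.
rewrite big_cons; apply: V1W; first by case: (sV x (mem_head _ _)).
by apply: V2V1 => // y ys; case: (sV y) => //; rewrite inE ys orbT.
Qed.

Lemma hausdorff_nbhs0 x : hausdorff_space A -> (forall W, nbhs (0 : A) W -> W x) -> x = 0.
Proof.
move=> hA hx; apply/esym/hA => U V U0 /nbhs_shift Vx.
have [W [W0 WN WU]] := nbhs0_half _ (filterI U0 Vx).
have W0' : W 0 by exact: nbhs_singleton.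
exists x; split; last by rewrite -(addr0 x); apply: (nbhs_singleton Vx).
by apply: hx.
Qed.

Lemma nbhs0_hausdorff : (forall x, (forall W, nbhs (0 : A) W -> W x) -> x = 0) ->
  hausdorff_space A.
Proof.
move=> h x y cxy; apply/eqP; rewrite -subr_eq0; apply/eqP/h => W W0.
have [V [V0 VN VW]] := nbhs0_half _ W0.
have nb z : nbhs z [set t | V (t - z)].
  by apply/nbhs_shift; apply: filterS V0 => t /=; rewrite addrAC subrr add0r.
have [t [/= tx ty]] := cxy _ _ (nb x) (nb y).
rewrite (_ : x - y = - (t - x) + (t - y)); first by apply: VW => //; exact: VN.
by rewrite opprB addrA subrK.
Qed.

Lemma closed_nbhs0 K x : closed K -> ~ K x ->
  exists2 W, nbhs (0 : A) W & forall w, W w -> ~ K (x + w).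
Proof.
move=> cK nKx; exists [set w | ~ K (x + w)] => //; apply/(nbhs_shift x (~` K)).
have : open (~` K) by exact: closed_openC.
by rewrite openE => /(_ x nKx).
Qed.

(** The closure of a symmetric [V] is contained in [V + V]. *)
Lemma closed_subnbhs W : nbhs (0 : A) W ->
  exists V, [/\ nbhs (0 : A) V, closed V & V `<=` W].
Proof.
move=> W0; have [V [V0 VN VW]] := nbhs0_half _ W0.
exists (closure V); split; [|exact: closed_closure|].
  by apply: filterS V0; exact: subset_closure.
move=> x cVx; have nb : nbhs x [set t | V (t - x)].
  by apply/nbhs_shift; apply: filterS V0 => t /=; rewrite addrAC subrr add0r.
have [t [Vt /= Vtx]] := cVx _ nb.
by rewrite (_ : x = t + - (t - x)); [apply: VW => //; exact: VN|rewrite opprB addrC subrK].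
Qed.

Lemma compact_add K L : compact K -> compact L ->
  compact [set x + y | x in K & y in L].
Proof.
move=> cK cL.
rewrite (_ : [set _ | _ in _ & _ in _] = (fun p : A * A => p.1 + p.2) @` (K `*` L)).
  apply: continuous_compact; last exact: compact_setX.
  by apply: continuous_subspaceT => p; exact: add_continuous.
apply/seteqP; split=> [z [x Kx [y Ly <-]]|z [[x y] [/= Kx Ly] <-]].
  by exists (x, y).
by exists x => //; exists y.
Qed.

Lemma compact_opp K : compact K -> compact [set - x | x in K].
Proof.
move=> cK; apply: continuous_compact => //.
by apply: continuous_subspaceT => p; exact: opp_continuous.
Qed.

(** Near covering, along the filter of finite families ordered by inclusion, is
    the extraction of a finite subcover. *)
Lemma compact_translates K V : compact K -> nbhs (0 : A) V ->
  exists s : seq A, forall x, K x -> exists2 y, y \in s & V (x - y).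
Proof.
move=> /compact_near_coveringP cK V0.
pose F : set_system (seq A) :=
  filter_from [set: seq A] (fun s => [set t : seq A | {subset s <= t}]).
have FF : Filter F.
  apply: filter_from_filter; first by exists [::].
  move=> s t _ _; exists (s ++ t) => // u stu.
  by split=> x xs; apply: stu; rewrite mem_cat xs ?orbT.
have := cK _ F (fun s x => exists2 y, y \in s & V (x - y)) FF.
case=> [x Kx|s _ sK]; last by exists s => x Kx; apply: sK.
exists ([set z | V (z - x)], [set t : seq A | x \in t]) => /=; last first.
  by move=> [z t] [/= Vzx xt]; exists x.
split; last by exists [:: x] => // t /= xt; apply: xt; rewrite inE.
by apply/nbhs_shift; apply: filterS V0 => t /=; rewrite addrAC subrr add0r.
Qed.

Lemma sub_nbhs_open V (S : zmodClosed A) : nbhs (0 : A) V -> V `<=` [set` S] ->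
  open [set` S].
Proof.
move=> V0 VS; rewrite openE => x Sx; apply/nbhs_shift.
by apply: filterS V0 => y /VS; exact: rpredD.
Qed.

Lemma open_subgroup_closed (S : zmodClosed A) : open [set` S] -> closed [set` S].
Proof.
move=> oS x cSx.
have : nbhs x [set y | y - x \in S].
  apply/nbhs_shift; have := oS; rewrite openE => /(_ 0 (rpred0 S)) S0.
  by apply: filterS S0 => y /=; rewrite addrAC subrr add0r.
move=> /cSx [y [/= Sy Syx]].
by have := rpredB Sy Syx; rewrite opprB addrC subrK.
Qed.

End Basics.

Lemma zmodClosed_of {G : zmodType} {P : set G} :
  P 0 -> (forall x y, P x -> P y -> P (x - y)) ->
  exists S : zmodClosed G, [set` S] = P.
Proof.
move=> P0 PB; pose p : {pred G} := [pred x | `[< P x >]].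
have zp : zmod_closed p.
  by split=> [|x y]; rewrite !inE; [|exact: PB].
pose S : zmodClosed G := HB.pack p (GRing.isZmodClosed.Build G p zp).
exists S; apply/seteqP; split=> x /=; rewrite /S /= /p.
  by move/asboolP.
by move=> Px; apply/asboolP.
Qed.

Lemma additive_of {U V : zmodType} (f : U -> V) : {morph f : x y / x - y} ->
  exists g : {additive U -> V}, (g : U -> V) = f.
Proof.
move=> fB; pose g : {additive U -> V} := HB.pack f (GRing.isZmodMorphism.Build U V f fB).
by exists g.
Qed.

Lemma zmodClosed_inj {G : zmodType} (S T : zmodClosed G) : [set` S] = [set` T] -> S = T.
Proof.
case: S T => [p [[hp1] [hp2]]] [q [[hq1] [hq2]]] /= pq.
have epq : p = q.
  apply/funext => x; apply/idP/idP => h.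
    have hx : [set` p] x := h. rewrite pq in hx; exact: hx.
  have hx : [set` q] x := h. rewrite -pq in hx; exact: hx.
subst q.
by rewrite (Prop_irrelevance hp1 hq1) (Prop_irrelevance hp2 hq2).
Qed.

Lemma nested_compact {T : topologicalType} {K : set T} {C : nat -> set T} :
  compact K -> (forall n, closed (C n)) -> (forall n, C n.+1 `<=` C n) ->
  (forall n, C n !=set0) -> C 0 `<=` K -> exists x, forall n, C n x.
Proof.
move=> cK clC Cn C0 CK.
have Cle m n : (m <= n)%N -> C n `<=` C m.
  by move=> /subnK <-; elim: (n - m)%N => [//|k IH] x /Cn /IH.
pose F : set_system T := filter_from [set: nat] C.
have FF : ProperFilter F.
  apply: filter_from_proper => //; apply: filter_from_filter; first by exists 0%N.
  move=> i j _ _; exists (maxn i j) => // x Cx.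
  by split; apply: Cle Cx; rewrite ?leq_maxl ?leq_maxr.
have [x [_ clx]] := cK F FF (ex_intro2 _ _ 0%N I CK).
exists x => n; apply: clC => U Ux.
by apply: clx => //; exists n.
Qed.

(** Otherwise the parts outside [U] would be nested, nonempty and compact. *)
Lemma nested_compact_sub {T : topologicalType} {K : set T} {C : nat -> set T} {U : set T} :
  compact K -> (forall n, closed (C n)) -> (forall n, C n.+1 `<=` C n) ->
  C 0 `<=` K -> open U -> (forall x, (forall n, C n x) -> U x) ->
  exists n, C n `<=` U.
Proof.
move=> cK clC Cn CK oU CU; apply: contrapT => /forallNP nU.
have [|||||x xP] := @nested_compact T K (fun n => C n `&` ~` U) => //.
- by move=> n; apply: closedI; [exact: clC|exact: open_closedC].
- by move=> n x [/Cn ? ?].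
- move=> n; have /existsNP [x /not_implyP [Cx nUx]] := nU n; by exists x.
- by move=> x [/CK].
by have [_] := xP 0%N; apply; apply: CU => n; case: (xP n).
Qed.

Section MoreBasics.
Context {A : topologicalZmodType}.
Implicit Types (U V W K L : set A) (x y : A).

Lemma mulrn_continuous n : continuous (fun x : A => x *+ n).
Proof.
elim: n => [|n IH].
  rewrite (_ : (fun x => _) = fun=> 0); first by move=> x; exact: cvg_cst.
  by apply/funext => y; rewrite mulr0n.
rewrite (_ : (fun x => _) = fun y => y + y *+ n); last by apply/funext => y; rewrite mulrS.
move=> x; apply: (@continuous_comp _ _ _ (fun y : A => (y, y *+ n)) (fun p : A * A => p.1 + p.2)).
  by apply: cvg_pair; [exact: cvg_id|exact: IH].
exact: add_continuous.
Qed.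

Lemma compact_muln K n : compact K -> compact [set x *+ n | x in K].
Proof.
move=> cK; apply: continuous_compact => //; apply: continuous_subspaceT.
exact: mulrn_continuous.
Qed.

Lemma LCA_nbhs : LCA A -> exists2 K, nbhs (0 : A) K & compact K.
Proof.
move=> [_ /(_ 0 I) [K + [cK _]]]; rewrite withinET => K0; by exists K.
Qed.

Lemma nbhs_LCA K : hausdorff_space A -> nbhs (0 : A) K -> compact K -> LCA A.
Proof.
move=> hA K0 cK; split=> // x _; rewrite withinET.
have cK' : compact [set x + y | y in K].
  apply: continuous_compact => //; apply: continuous_subspaceT; exact: shift_continuous.
exists [set x + y | y in K]; last by split=> //; exact: compact_closed.
by apply/nbhs_shift; apply: filterS K0 => y Ky /=; exists y.
Qed.

Lemma additive_continuous {B : topologicalZmodType} (f : {additive A -> B}) :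
  (forall W : set B, nbhs (0 : B) W -> nbhs (0 : A) (f @^-1` W)) -> continuous f.
Proof.
move=> f0 x W /nbhs_shift /f0 h; apply/nbhs_shift.
by apply: filterS h => y /=; rewrite raddfD.
Qed.

Lemma connected_open_subgroup (S : zmodClosed A) : connected [set: A] ->
  open [set` S] -> forall x, x \in S.
Proof.
move=> cA oS x; change ([set` S] x); rewrite (cA [set` S])//.
- by exists 0; exact: rpred0.
- by exists [set` S]; rewrite ?setTI.
- by exists [set` S]; rewrite ?setTI//; exact: open_subgroup_closed.
Qed.

End MoreBasics.

Lemma pair_continuous {X Y Z : topologicalType} {f : X -> Y} {g : X -> Z} :
  continuous f -> continuous g -> continuous (fun x => (f x, g x)).
Proof. by move=> cf cg x; apply: cvg_pair; [exact: cf|exact: cg]. Qed.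

Lemma id_continuous {X : topologicalType} : continuous (fun x : X => x).
Proof. by move=> x; exact: cvg_id. Qed.

Lemma add_fun_continuous {X : topologicalType} {Y : topologicalZmodType} (f g : X -> Y) :
  continuous f -> continuous g -> continuous (fun x => f x + g x).
Proof.
move=> cf cg x; apply: (@continuous_comp _ _ _ (fun x => (f x, g x)) (fun q : Y * Y => q.1 + q.2)).
  exact: pair_continuous.
exact: add_continuous.
Qed.

(** * Multiples of an element modulo a subgroup *)

Section Weil.
Context {A : topologicalZmodType}.
Variables (N : zmodClosed A) (x : A).

(** If infinitely many multiples of [x] meet a compact set modulo [N], then
    infinitely many of them are close to each other, and their differences are
    close to [0]. *)
Lemma recurrent_multiples (K : set A) : compact K ->
  (forall M : nat, exists n : int, (M <= `|n|)%N /\ exists2 w, K w & x *~ n - w \in N) ->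
  forall W, nbhs (0 : A) W -> forall M : nat,
    exists m : nat, (M < m)%N /\ exists2 w, W w & x *+ m - w \in N.
Proof.
move=> cK hK W W0 M; have [V [V0 VN VW]] := nbhs0_half _ W0.
have [s sK] := compact_translates _ _ cK V0.
pose near y (n : int) := exists2 v, V v & x *~ n - (y + v) \in N.
have [y yinf] : exists y, forall M : nat, exists n, (M <= `|n|)%N /\ near y n.
  apply: contrapT => /forallNP nfin.
  have /choice [b bP] : forall y, exists B : nat, forall n, near y n -> (`|n| < B)%N.
    move=> y; have /existsNP [B /forallNP hB] := nfin y; exists B => n yn.
    by rewrite ltnNge; apply/negP => Bn; apply: (hB n).
  have [n [nM [w Kw nw]]] := hK (\sum_(y <- s) b y)%N.
  have [y ys Vwy] := sK w Kw.
  have : near y n by exists (w - y) => //; rewrite [y + _]addrC subrK.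
  move=> /bP; apply/negP; rewrite -leqNgt; apply: leq_trans nM.
  by rewrite (big_rem y ys) leq_addr.
have [n1 [_ [v1 Vv1 h1]]] := yinf 0%N.
have [n2 [n2M [v2 Vv2 h2]]] := yinf (`|n1| + M.+1)%N.
have d12 : (M < `|n2 - n1|)%N by lia.
have hd : x *~ (n2 - n1) - (v2 - v1) \in N.
  by have := rpredB h2 h1; rewrite mulrzBr; congr (_ \in N); zmod.
exists `|n2 - n1|%N; split=> //.
have [le|lt] := leP 0 (n2 - n1).
  exists (v2 - v1); first by apply: VW => //; exact: VN.
  by rewrite pmulrn gez0_abs.
exists (v1 - v2); first by apply: VW => //; exact: VN.
by rewrite pmulrn ltz0_abs // mulrNz -(opprB v2) -opprD rpredN.
Qed.

(** Weil's dichotomy between discrete and relatively compact monothetic groups,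
    relative to [N]. The part of a compact neighbourhood of [0] near which
    multiples of [x] occur is reached, by compactness, by the [j x] with
    [0 < j <= n0]. Given any [n], the least positive [m] such that [m x] is
    close to [n x] modulo [N] is then at most [n0], for otherwise one such [j]
    could be subtracted from it. *)
Lemma relatively_compact_multiples : LCA A ->
  (forall W, nbhs (0 : A) W -> forall M : nat,
    exists m : nat, (M < m)%N /\ exists2 w, W w & x *+ m - w \in N) ->
  exists2 K : set A, compact K & forall n : int, exists2 w, K w & x *~ n - w \in N.
Proof.
move=> /LCA_nbhs [V V0 cV] rec.
have W0 : nbhs (0 : A) (V `&` [set y | V (- y)]) by apply: filterI => //; exact: nbhs0_opp.
have [U [U0 UN UW]] := nbhs0_sums 3 _ W0.
have U3 a b c : U a -> U b -> U c -> (V `&` [set y | V (- y)]) (a + b + c).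
  move=> Ua Ub Uc; rewrite (_ : a + b + c = \sum_(y <- [:: a; b; c]) y).
    by apply: UW => // y; rewrite !inE => /or3P [] /eqP ->.
  by rewrite !big_cons big_nil; zmod.
have U0' : U 0 by exact: nbhs_singleton.
have [s sV] := compact_translates _ _ cV U0.
pose H v := exists n : int, v - x *~ n \in N.
(* one positive multiple of x per translate reaches all of V modulo N *)
have /choice [b bP] : forall y, exists j : nat, (0 < j)%N /\
    forall v, U (v - y) -> H v ->
      exists2 w, (V `&` [set y | V (- y)]) w & v - x *+ j - w \in N.
  move=> y; have [[h [Uhy [n hn]]]|nex] := pselect (exists h, U (h - y) /\ H h); last first.
    by exists 1%N; split=> // v Uvy Hv; case: nex; exists v.
  have [m [nm [w Uw mw]]] := rec U U0 `|n|%N.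
  exists (absz (n + m%:Z)); split; first lia.
  move=> v Uvy Hv; exists (v - y + - (h - y) + - w); first by apply: U3 => //; exact: UN.
  rewrite pmulrn gez0_abs; last by lia.
  rewrite mulrzDr -pmulrn.
  have := rpredB hn mw.
  by congr (_ \in N); zmod.
pose n0 := (\sum_(y <- s) b y)%N.
have n0P v : V v -> H v -> exists j : nat, (0 < j <= n0)%N /\
    exists2 w, (V `&` [set y | V (- y)]) w & v - x *+ j - w \in N.
  move=> Vv Hv; have [y ys Uvy] := sV v Vv; have [by0 byP] := bP y.
  exists (b y); split; last exact: byP.
  by rewrite by0 /n0 (big_rem y ys) leq_addr.
pose good (n : int) (m : nat) :=
  `[< (0 < m)%N /\ exists2 w, (V `&` [set y | V (- y)]) w & x *+ m - x *~ n - w \in N >].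
have good_le n : exists m : nat, (0 < m <= n0)%N /\
    exists2 w, (V `&` [set y | V (- y)]) w & x *+ m - x *~ n - w \in N.
  have exg : exists m, good n m.
    have [m [nm [w Uw mw]]] := rec U U0 `|n|%N.
    exists (absz (m%:Z + n)); apply/asboolP; split; first lia.
    exists w; first by rewrite -(addr0 w) -(addr0 (w + 0)); exact: U3.
    rewrite pmulrn gez0_abs; last by lia.
    by rewrite mulrzDr -pmulrn; move: mw; congr (_ \in N); zmod.
  case: (ex_minnP exg) => m /asboolP [m0 [w Ww mw]] mmin.
  exists m; split; last by exists w.
  rewrite m0 leqNgt; apply/negP => ltm.
  have Hw : H w.
    exists (m%:Z - n); rewrite mulrzBr -pmulrn -opprB rpredN.
    by move: mw; congr (_ \in N); zmod.
  have [j [/andP [j0 jn] [w' Ww' jw']]] := n0P w (proj1 Ww) Hw.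
  suff /mmin : good n (m - j)%N by lia.
  apply/asboolP; split; first lia.
  exists w' => //; rewrite mulrnBr; last by lia.
  by have := rpredD mw jw'; congr (_ \in N); zmod.
exists [set p - q | p in [set x *+ m | m in `I_n0.+1] & q in V].
  rewrite (_ : [set _ | _ in _ & _ in _] =
    [set p + q | p in [set x *+ m | m in `I_n0.+1] & q in [set - v | v in V]]).
    apply: compact_add; last exact: compact_opp.
    by apply: finite_compact; exact: finite_image.
  apply/seteqP; split=> [z [p Pp [v Vv <-]]|z [p Pp [_ [v Vv <-] <-]]].
    by exists p => //; exists (- v) => //; exists v.
  by exists p => //; exists v.
move=> n; have [m [/andP [_ mn0] [w [Vw _] mw]]] := good_le n.
exists (x *+ m - w); first by exists (x *+ m); [exists m|exists w].
by rewrite -rpredN; move: mw; congr (_ \in N); zmod.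
Qed.
End Weil.

(** * Finitely generated subgroups as coarse lattices *)

Lemma normrV_le {R : realType} k (v : 'rV[R]_k) (M : R) : 0 <= M ->
  (`|v| <= M) <-> (forall i, `|v 0 i| <= M).
Proof.
move=> M0; rewrite -[`|v|]/(mx_norm v) mx_normrE; split=> [/bigmax_leP [_ h] i|h].
  exact: (h (0, i)).
by apply/bigmax_leP; split=> // -[i j] _; rewrite /= ord1.
Qed.

Section CoarseLattice.
Context {A : topologicalZmodType} (R : realType).

(** [P] stays at bounded distance from the image of an abelian group [Z] that
    is coarsely embedded both in [A] and in a real vector space: this is how
    the rank of a finitely generated subgroup of [A] is measured. *)
Definition coarsely_lattice (P : set A) : Prop :=
  exists (k : nat) (Z : zmodType) (s : {additive Z -> A}) (i : {additive Z -> 'rV[R]_k}),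
  [/\ exists2 K, compact K & forall x, P x -> exists z, K (x - s z),
      forall L, compact L -> exists M : R, forall z, L (s z) -> `|i z| <= M
    & forall M : R, exists2 L, compact L & forall z, `|i z| <= M -> L (s z)].

Fixpoint zspan (l : seq A) : set A :=
  if l is x :: l' then [set y | exists n : int, zspan l' (y - x *~ n)] else [set 0].

Lemma zspanB l x y : zspan l x -> zspan l y -> zspan l (x - y).
Proof.
elim: l x y => [|a l IH] x y /=; first by move=> -> ->; rewrite subrr.
move=> [m xm] [n yn]; exists (m - n); rewrite mulrzBr.
by have := IH _ _ xm yn; congr (zspan l _); zmod.
Qed.

Lemma zspan0 l : zspan l 0.
Proof. by elim: l => [|a l IH] //=; exists 0; rewrite mulr0z subr0. Qed.

Lemma zspan_mem l x : x \in l -> zspan l x.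
Proof.
elim: l => [|a l IH] //=; rewrite inE => /orP [/eqP ->|/IH xl].
  by exists 1; rewrite mulr1z subrr; exact: zspan0.
by exists 0; rewrite mulr0z subr0.
Qed.

(** By Weil's dichotomy, each new generator either stays at bounded distance
    from the lattice found so far, or is independent of it and adds one
    coordinate. *)
Lemma zspan_coarsely_lattice (l : seq A) : LCA A -> coarsely_lattice (zspan l).
Proof.
move=> lcA; elim: l => [|x l [k [Z [s [i [[K cK hK] h1 h2]]]]]].
  have [s sE] := additive_of (fun _ : int => 0 : A) (fun x y => esym (subrr 0)).
  have [i iE] := additive_of (fun _ : int => 0 : 'rV[R]_0) (fun x y => esym (subrr 0)).
  exists 0%N, int, s, i; split.
  - by exists [set 0]; [exact: compact_set1|move=> y /= ->; exists 0; rewrite sE subrr].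
  - by move=> L _; exists 0 => z _; rewrite iE normr0.
  - by move=> M; exists [set 0]; [exact: compact_set1|move=> z _; rewrite sE].
have [N NE] : exists N : zmodClosed A, [set` N] = range s.
  apply: zmodClosed_of; first by exists 0; rewrite ?raddf0.
  by move=> _ _ [u _ <-] [v _ <-]; exists (u - v); rewrite ?raddfB.
have NP y : (y \in N) <-> exists z, y = s z.
  by change ([set` N] y <-> exists z, y = s z); rewrite NE; split=> [[z _ <-]|[z ->]]; exists z.
have [prop|nprop] := pselect (forall L, compact L -> exists M : nat, forall n : int,
    (exists2 w, L w & x *~ n - w \in N) -> (`|n| < M)%N); last first.
  have [L cL hL] : exists2 L, compact L & forall M : nat, exists n : int,
      (M <= `|n|)%N /\ exists2 w, L w & x *~ n - w \in N.
    move: nprop => /existsNP [L /not_implyP [cL /forallNP hL]]; exists L => // M.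
    have /existsNP [n /not_implyP [nw /negP]] := hL M; rewrite -leqNgt => nM.
    by exists n.
  have [L2 cL2 hL2] := relatively_compact_multiples _ _ lcA (recurrent_multiples _ _ _ cL hL).
  exists k, Z, s, i; split=> //.
  exists [set a + b | a in K & b in L2]; first exact: compact_add.
  move=> y /= [n /hK [z Kz]]; have [w L2w /NP [z' hz']] := hL2 n.
  exists (z + z'); exists (y - x *~ n - s z) => //; exists w => //.
  by rewrite raddfD -hz'; zmod.
have [s' s'E] : exists g : {additive (Z * int)%type -> A},
    (g : Z * int -> A) = (fun p => s p.1 + x *~ p.2).
  by apply: additive_of => p q /=; rewrite raddfB mulrzBr; zmod.
have [i' i'E] : exists g : {additive (Z * int)%type -> 'rV[R]_(k + 1)},
    (g : Z * int -> _) = (fun p => row_mx (i p.1) (const_mx p.2%:~R)).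
  apply: additive_of => p q /=.
  rewrite raddfB opp_row_mx add_row_mx; congr row_mx.
  by apply/rowP => j; rewrite !mxE intrB.
have i'P p (M : R) : 0 <= M -> `|i' p| <= M <-> `|i p.1| <= M /\ `|p.2%:~R : R| <= M.
  move=> M0; rewrite i'E !normrV_le //; split.
    move=> h; split=> [j|]; first by have := h (lshift 1 j); rewrite row_mxEl.
    by have := h (rshift k 0); rewrite row_mxEr mxE.
  move=> [h3 h4] j; rewrite -(splitK j); case: (fintype.split j) => j' /=.
    by rewrite row_mxEl.
  by rewrite row_mxEr mxE.
pose fin_mul (M : nat) := [set x *~ n | n in [set n : int | (`|n| < M)%N]].
have cfin M : compact (fin_mul M).
  apply: finite_compact; apply: finite_image.
  apply: (@sub_finite_set _ _ (Posz @` `I_M `|` (fun m : nat => - m%:Z) @` `I_M)).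
    move=> n /= nM; have [n0|n0] := leP 0 n; [left|right].
      by exists `|n|%N => //; rewrite gez0_abs.
    by exists `|n|%N => //; rewrite ltz0_abs ?opprK.
  by rewrite finite_setU; split; apply: finite_image; exact: finite_II.
exists (k + 1)%N, (Z * int)%type, s', i'; split.
- exists K => // y /= [n /hK [z Kz]]; exists (z, n); rewrite s'E /=.
  by move: Kz; congr K; zmod.
- move=> L cL; have [M hM] := prop L cL.
  have cB : compact [set a + b | a in L & b in [set - y | y in fin_mul M]].
    by apply: compact_add => //; apply: compact_opp.
  have [M1 hM1] := h1 _ cB.
  exists (Num.max (Num.max 0 M1) M%:R) => -[z n]; rewrite s'E /= => Lzn.
  have nM : (`|n| < M)%N.
    apply: hM; exists (s z + x *~ n) => //; apply/NP; exists (- z).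
    by rewrite raddfN; zmod.
  apply/i'P; first by rewrite !le_max lexx.
  split; last by rewrite le_max -intr_norm -natr_absz ler_nat ltnW ?orbT.
  rewrite !le_max hM1 ?orbT //.
  exists (s z + x *~ n) => //; exists (- (x *~ n)); last by zmod.
  by exists (x *~ n) => //; exists n.
- move=> M; have [L cL hL] := h2 (Num.max 0 M).
  pose m := (Num.bound (Num.max 0 M)).
  exists [set a + b | a in L & b in fin_mul m]; first exact: compact_add.
  move=> z zM; have {zM} /i'P : `|i' z| <= Num.max 0 M by rewrite le_max zM orbT.
  rewrite le_max lexx => /(_ isT) [izM zM]; rewrite s'E.
  exists (s z.1); first exact: hL.
  exists (x *~ z.2) => //; exists z.2 => //=.
  rewrite -(ltr_nat R) natr_absz intr_norm; apply: le_lt_trans zM _.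
  by apply: archi_boundP; rewrite le_max lexx.
Qed.
End CoarseLattice.

(** * From a coarse lattice to a proper homomorphism to a real vector space *)

(** Homogenisation of a map that is additive up to a bounded error: the error
    on [q (2 ^ n x)] is divided by [2 ^ n], and commutativity of the group makes
    [2 ^ n (x + y)] equal to [2 ^ n x + 2 ^ n y]. *)
Lemma homogenize {R : realType} {G : zmodType} {S : zmodClosed G} {q : G -> R} {C : R} :
  {in S &, forall x y, `|q (x + y) - q x - q y| <= C} ->
  exists2 phi : G -> R, {in S &, {morph phi : x y / x + y}} &
    {in S, forall x, `|phi x - q x| <= C}.
Proof.
move=> hq.
have C0 : 0 <= C by apply: le_trans (normr_ge0 _) (hq 0 0 (rpred0 S) (rpred0 S)).
pose u x n := q (x *+ (2 ^ n)) / 2 ^+ n.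
have p2 n : 0 < (2 ^+ n : R) by rewrite exprn_gt0.
have ustep x n : x \in S -> `|u x n.+1 - u x n| <= C / 2 ^+ n.+1.
  move=> Sx; have Sx2 : x *+ (2 ^ n) \in S by exact: rpredMn.
  have := hq _ _ Sx2 Sx2; rewrite -mulrnDr addnn -mul2n -expnS => h.
  rewrite (_ : u x n.+1 - u x n = (q (x *+ 2 ^ n.+1) - q (x *+ 2 ^ n) - q (x *+ 2 ^ n)) / 2 ^+ n.+1).
    by rewrite normrM normfV (gtr0_norm (p2 _)) ler_pM2r // invr_gt0.
  rewrite /u exprS; field; exact: lt0r_neq0.
have Chalf n : C / 2 ^+ n = C / 2 ^+ n.+1 + C / 2 ^+ n.+1.
  by rewrite exprS; field; exact: lt0r_neq0.
(* u x n - C / 2 ^ n increases and u x n + C / 2 ^ n decreases *)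
have low x : x \in S -> nondecreasing_seq (fun n => u x n - C / 2 ^+ n).
  move=> Sx; apply/nondecreasing_seqP => n; have := ustep x n Sx.
  by rewrite (Chalf n) ler_norml => /andP [h _]; lra.
have upp x : x \in S -> nonincreasing_seq (fun n => u x n + C / 2 ^+ n).
  move=> Sx; apply/nonincreasing_seqP => n; have := ustep x n Sx.
  by rewrite (Chalf n) ler_norml => /andP [_ h]; lra.
have u0 x : u x 0%N = q x by rewrite /u expn0 expr0 mulr1n divr1.
have Cn0 n : 0 <= C / 2 ^+ n by rewrite divr_ge0 // ltW.
have lowq x n : x \in S -> q x - C <= u x n - C / 2 ^+ n.
  by move=> /low /(_ 0%N n (leq0n n)); rewrite u0 expr0 divr1.
have uppq x n : x \in S -> u x n + C / 2 ^+ n <= q x + C.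
  by move=> /upp /(_ 0%N n (leq0n n)); rewrite u0 expr0 divr1.
have C2 : C / 2 ^+ n @[n --> \oo] --> (0 : R).
  rewrite -(mulr0 C); apply: cvgM; first exact: cvg_cst.
  under eq_fun => n do rewrite -exprVn.
  by apply: cvg_expr; rewrite ger0_norm; lra.
have ucvg x : x \in S -> cvgn (u x).
  move=> Sx; suff h : cvgn (fun n => u x n - C / 2 ^+ n).
    rewrite (_ : u x = (fun n => (u x n - C / 2 ^+ n) + C / 2 ^+ n)).
      by apply: is_cvgD => //; apply/cvg_ex; exists 0.
    by apply/funext => n; rewrite subrK.
  apply: nondecreasing_is_cvgn; first exact: low.
  exists (q x + C) => _ [n _ <-]; have := uppq x n Sx; have := Cn0 n; lra.
exists (fun x => limn (u x)).
  move=> x y Sx Sy; have Sxy : x + y \in S by exact: rpredD.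
  apply/eqP; rewrite -subr_eq0 opprD addrA; apply/eqP.
  have h1 : u (x + y) n - u x n - u y n @[n --> \oo] --> limn (u (x + y)) - limn (u x) - limn (u y).
    by apply: cvgB; [apply: cvgB|]; exact: ucvg.
  apply: (cvg_unique _ h1); first exact: Rhausdorff.
  apply/norm_cvg0P; apply: (squeeze_cvgr _ (@cvg_cst _ (0 : R) _ _ _) C2).
  near=> n; rewrite normr_ge0 /=.
  rewrite (_ : u (x + y) n - u x n - u y n =
    (q (x *+ 2 ^ n + y *+ 2 ^ n) - q (x *+ 2 ^ n) - q (y *+ 2 ^ n)) / 2 ^+ n).
    rewrite normrM normfV (gtr0_norm (p2 _)) ler_pM2r ?invr_gt0 //.
    by apply: hq; exact: rpredMn.
  by rewrite /u mulrnDl; field; exact: lt0r_neq0.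
move=> x Sx /=; rewrite ler_norml; apply/andP; split.
  rewrite lerBrDr addrC; apply: limr_ge; first exact: ucvg.
  by near=> n; have := lowq x n Sx; have := Cn0 n; lra.
rewrite lerBlDr addrC; apply: limr_le; first exact: ucvg.
by near=> n; have := uppq x n Sx; have := Cn0 n; lra.
Unshelve. all: by end_near.
Qed.

Section AdditiveOn.
Context {G H : zmodType} {S : zmodClosed G} {f : G -> H}.
Hypothesis fD : {in S &, {morph f : x y / x + y}}.

Lemma additive_on0 : f 0 = 0.
Proof. by apply: (addrI (f 0)); rewrite -fD ?rpred0 // !addr0. Qed.

Lemma additive_onB : {in S &, {morph f : x y / x - y}}.
Proof.
move=> x y Sx Sy; apply: (addIr (f y)).
by rewrite -fD ?rpredB // !subrK.
Qed.

Lemma additive_onMn x n : x \in S -> f (x *+ n) = f x *+ n.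
Proof.
move=> Sx; elim: n => [|n IH]; first by rewrite !mulr0n additive_on0.
by rewrite !mulrS fD ?IH // rpredMn.
Qed.
End AdditiveOn.

(** Only the restriction of [phi] to [G] is meaningful. A map defined everywhere
    lets [G] shrink without changing the type of [phi]. *)
Definition proper_hom {R : realType} {A : topologicalZmodType} {k : nat}
    (G : zmodClosed A) (phi : A -> 'rV[R]_k) : Prop :=
  [/\ open [set` G], {in G &, {morph phi : x y / x + y}},
      forall e, 0 < e -> nbhs (0 : A) [set x | x \in G /\ `|phi x| < e]
    & forall M, exists2 K, compact K & forall x, x \in G -> `|phi x| <= M -> K x].

(** [G] is generated by a compact neighbourhood [U]; covering [U + U] by finitely
    many translates of [U] gives [G = U + N] with [N] finitely generated. The
    coordinates of a lattice point near [x] depend on [x] additively up to a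
    bounded error, because only boundedly many lattice points are near [0]. *)
Lemma proper_hom_exists (R : realType) (A : topologicalZmodType) : LCA A ->
  exists (k : nat) (G : zmodClosed A) (phi : A -> 'rV[R]_k), proper_hom G phi.
Proof.
move=> lcA; have [K0 K00 cK0] := LCA_nbhs lcA.
pose U := K0 `|` [set - x | x in K0].
have cU : compact U by apply: compactU => //; exact: compact_opp.
have U0 : nbhs (0 : A) U by apply: filterS K00 => x; left.
have UN x : U x -> U (- x).
  by case=> [Kx|[y Ky <-]]; [right; exists x|left; rewrite opprK].
have [l lU] := compact_translates _ _ (compact_add _ _ cU cU) U0.
have [G GE] : exists G : zmodClosed A, [set` G] = [set g | exists2 u, U u & zspan l (g - u)].
  apply: zmodClosed_of.
    by exists 0; [exact: nbhs_singleton|rewrite subr0; exact: zspan0].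
  move=> g h [u Uu gu] [v Vv hv].
  have [|y yl Uy] := lU (u - v); first by exists u => //; exists (- v) => //; exact: UN.
  exists (u - v - y) => //.
  have := zspanB _ _ _ (zspanB _ _ _ gu hv) (zspanB _ _ _ (zspan0 l) (zspan_mem _ _ yl)).
  by congr (zspan l _); zmod.
have GP g : g \in G <-> exists2 u, U u & zspan l (g - u).
  by change ([set` G] g <-> exists2 u, U u & zspan l (g - u)); rewrite GE.
have UG x : U x -> x \in G by move=> Ux; apply/GP; exists x; rewrite // subrr; exact: zspan0.
have oG : open [set` G] by apply: sub_nbhs_open U0 _ => x; exact: UG.
have [k [Z [s [i [[K cK hK] h1 h2]]]]] := zspan_coarsely_lattice R l lcA.
pose K2 := [set a + b | a in U & b in K].
have cK2 : compact K2 by exact: compact_add.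
have /choice [z zP] : forall g, exists z, g \in G -> K2 (g - s z).
  move=> g; have [/GP [u Uu /hK [z Kz]]|nG] := boolP (g \in G); last by exists 0.
  by exists z => _; exists u => //; exists (g - u - s z) => //; zmod.
have [C1 hC1] := h1 _ (compact_add _ _ (compact_add _ _ cK2 cK2) (compact_opp _ cK2)).
pose C := Num.max 0 C1.
have C_ge0 : 0 <= C by rewrite le_max lexx.
pose q g := i (z g).
have qq : {in G &, forall x y, `|q (x + y) - q x - q y| <= C}.
  move=> x y Gx Gy; rewrite /q -!raddfB le_max hC1 ?orbT //.
  exists (x - s (z x) + (y - s (z y))).
    by exists (x - s (z x)); [exact: zP|exists (y - s (z y)) => //; exact: zP].
  exists (- (x + y - s (z (x + y)))).
    by exists (x + y - s (z (x + y))) => //; apply: zP; exact: rpredD.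
  by rewrite !(raddfB s); zmod.
have /choice [phi phiP] : forall j : 'I_k, exists phi : A -> R,
    {in G &, {morph phi : x y / x + y}} /\ {in G, forall x, `|phi x - q x 0 j| <= C}.
  move=> j; have [|phi h3 h4] := @homogenize R A G (fun x => q x 0 j) C; last by exists phi.
  move=> x y Gx Gy; have /normrV_le := qq x y Gx Gy.
  by move=> /(_ C_ge0 j); rewrite !mxE.
exists k, G, (fun x => \row_j phi j x).
have phiq x : x \in G -> `|(\row_j phi j x) - q x| <= C.
  by move=> Gx; apply/normrV_le => // j; rewrite !mxE; apply: (phiP j).2.
have phiD : {in G &, {morph (fun x => \row_j phi j x) : x y / x + y}}.
  by move=> x y Gx Gy; apply/rowP => j; rewrite !mxE (phiP j).1.
split=> //.
- have [M hM] := h1 _ (compact_add _ _ cU (compact_opp _ cK2)).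
  move=> e e0; pose n := Num.bound ((Num.max 0 M + C) / e).
  have n0 : 0 < n%:R :> R.
    by apply: le_lt_trans (archi_boundP _); rewrite divr_ge0 ?(ltW e0)// addr_ge0// le_max lexx.
  have Un : nbhs (0 : A) [set x | U (x *+ n)].
    by have := @mulrn_continuous A n 0; rewrite /continuous_at mul0rn => /(_ _ U0).
  have G0 : nbhs (0 : A) [set` G] by apply: filterS U0 => x /UG.
  apply: filterS (filterI Un G0) => x [/= Ux Gx]; split=> //.
  have := phiq _ (UG _ Ux).
  rewrite (additive_onMn phiD _ n Gx) => h.
  have qM : `|q (x *+ n)| <= Num.max 0 M.
    rewrite le_max hM ?orbT //; exists (x *+ n) => //.
    exists (- (x *+ n - s (z (x *+ n)))); last by zmod.
    by exists (x *+ n - s (z (x *+ n))) => //; apply: zP; exact: UG.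
  have : `|(\row_j phi j x) *+ n| <= Num.max 0 M + C.
    rewrite -[_ *+ n](subrK (q (x *+ n))) addrC; apply: le_trans (ler_normD _ _) _.
    exact: lerD.
  rewrite normrMn -mulr_natr -ler_pdivlMr // => /le_lt_trans; apply.
  rewrite ltr_pdivrMr // mulrC -ltr_pdivrMr //; apply: archi_boundP.
  by rewrite divr_ge0 ?(ltW e0)// addr_ge0// le_max lexx.
- move=> M; have [L cL hL] := h2 (M + C).
  exists [set a + b | a in K2 & b in L]; first exact: compact_add.
  move=> x Gx xM; exists (x - s (z x)); first exact: zP.
  exists (s (z x)); last by rewrite subrK.
  apply: hL; rewrite -/(q x) -[q x](subrK (\row_j phi j x)) addrC.
  by apply: le_trans (ler_normD _ _) _; rewrite lerD // distrC phiq.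
Qed.

Lemma normrV_mulmx {R : realType} {m n} (B : 'M[R]_(m, n)) :
  exists2 c : R, 0 < c & forall v : 'rV[R]_m, `|v *m B| <= c * `|v|.
Proof.
exists (1 + \sum_i `|row i B|).
  by rewrite ltr_pwDl // sumr_ge0.
move=> v; rewrite mulmx_sum_row; apply: le_trans (ler_norm_sum _ _ _) _.
rewrite mulrDl mul1r mulr_suml.
apply: (@le_trans _ _ (\sum_i `|row i B| * `|v|)); last by rewrite lerDr.
apply: ler_sum => i _; rewrite normrZ mulrC ler_wpM2l //.
by have /normrV_le := lexx `|v|; apply.
Qed.

Section ProperHom.
Context {R : realType} {A : topologicalZmodType} {k : nat}.
Context {G : zmodClosed A} {phi : A -> 'rV[R]_k}.
Hypothesis Gphi : proper_hom G phi.

Lemma proper_homB : {in G &, {morph phi : x y / x - y}}.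
Proof. by case: Gphi => _ D _ _; exact: additive_onB. Qed.

Lemma proper_hom_compact v M : compact [set x | x \in G /\ `|phi x - v| <= M].
Proof.
have [oG D C0 P] := Gphi; have [K cK hK] := P (M + `|v|).
apply: (subclosed_compact _ cK); last first.
  move=> x [Gx xM]; apply: hK => //.
  by rewrite -[phi x](subrK v); apply: le_trans (ler_normD _ _) _; rewrite lerD2r.
move=> x cx; have Gx : x \in G.
  apply: (open_subgroup_closed G oG) => U /cx [y [[Gy _] Uy]]; by exists y.
split=> //; apply/ler_addgt0Pr => e e0.
have nb : nbhs x [set y | y - x \in G /\ `|phi (y - x)| < e].
  apply/nbhs_shift; apply: filterS (C0 e e0) => y /=.
  by rewrite addrAC subrr add0r.
have [y [[/= Gy yM] [_]]] := cx _ nb; rewrite proper_homB // => h.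
rewrite (_ : phi x - v = (phi y - v) - (phi y - phi x)); last by zmod.
by apply: le_trans (ler_normB _ _) _; rewrite lerD // ltW.
Qed.

Lemma proper_hom_onto_of_dense : hausdorff_space A ->
  (forall v e, 0 < e -> exists2 x, x \in G & `|phi x - v| <= e) ->
  forall v, exists2 x, x \in G & phi x = v.
Proof.
move=> hA dense v.
pose C n := [set x | x \in G /\ `|phi x - v| <= n.+1%:R^-1].
have cC n : compact (C n) by exact: proper_hom_compact.
have [||||x xP] := nested_compact (cC 0%N) (C := C).
- by move=> n; apply: compact_closed.
- move=> n x [Gx xn]; split=> //; apply: le_trans xn _.
  by rewrite lef_pV2 ?posrE ?ltr0n // ler_nat.
- move=> n; have [|x Gx xn] := dense v n.+1%:R^-1; first by rewrite invr_gt0 ltr0n.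
  by exists x.
- by [].
exists x; first by case: (xP 0%N).
apply/eqP; rewrite -subr_eq0 -normr_eq0 eq_le normr_ge0 andbT.
apply/ler_addgt0Pr => e e0; rewrite add0r.
have [_ /le_trans] := xP (Num.bound e^-1); apply.
rewrite -[leRHS]invrK lef_pV2 ?posrE ?invr_gt0 ?ltr0n //.
apply: ltW; apply: lt_trans (archi_boundP _) _; first by rewrite invr_ge0 ltW.
by rewrite ltr_nat.
Qed.
End ProperHom.

(** Vectors in the row space of [B] are recovered from their coordinates, given
    by a partial inverse of [B]; hence replacing the values of [phi] by these
    coordinates preserves properness. *)
Lemma proper_hom_reduce {R : realType} {A : topologicalZmodType} {k r : nat}
    {G : zmodClosed A} {phi : A -> 'rV[R]_k} {B : 'M[R]_(r, k)} {e : R} :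
  proper_hom G phi -> 0 < e ->
  (forall x, x \in G -> `|phi x| < e -> (phi x <= B)%MS) ->
  exists (G' : zmodClosed A) (phi' : A -> 'rV[R]_r), proper_hom G' phi'.
Proof.
move=> [oG D C0 P] e0 hB.
have [G' GE] : exists G' : zmodClosed A,
    [set` G'] = [set x | x \in G /\ (phi x <= B)%MS].
  apply: zmodClosed_of; first by rewrite /= rpred0 (additive_on0 D) sub0mx.
  move=> x y [Gx xB] [Gy yB] /=; split; first exact: rpredB.
  by rewrite (additive_onB D) // addmx_sub // eqmx_opp.
have GP x : x \in G' <-> x \in G /\ (phi x <= B)%MS.
  by change ([set` G'] x <-> x \in G /\ (phi x <= B)%MS); rewrite GE.
have [c c0 hc] := normrV_mulmx (pinvmx B).
have [c' c'0 hc'] := normrV_mulmx B.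
exists G', (fun x => phi x *m pinvmx B); split.
- apply: sub_nbhs_open (C0 e e0) _ => x [Gx xe]; apply/GP; split=> //.
  exact: hB.
- by move=> x y /GP [Gx _] /GP [Gy _]; rewrite D // mulmxDl.
- move=> d d0; apply: filterS (filterI (C0 _ e0) (C0 (d / c) (divr_gt0 d0 c0))).
  move=> x [[Gx xe] [_ xd]]; split; first by apply/GP; split=> //; exact: hB.
  by apply: le_lt_trans (hc _) _; rewrite mulrC -ltr_pdivlMr.
- move=> M; have [K cK hK] := P (c' * M); exists K => // x /GP [Gx xB] xM.
  apply: hK => //; rewrite -(mulmxKpV xB); apply: le_trans (hc' _) _.
  by rewrite ler_pM2l.
Qed.

(** The rank of the target is minimal, so arbitrarily small values of [phi]
    span it; their integral combinations are then dense, and properness makes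
    the image closed. *)
Lemma proper_hom_onto (R : realType) (A : topologicalZmodType) : LCA A ->
  exists (k : nat) (G : zmodClosed A) (phi : A -> 'rV[R]_k),
    proper_hom G phi /\ forall v, exists2 x, x \in G & phi x = v.
Proof.
move=> lcA.
have exk : exists k, `[< exists (G : zmodClosed A) (phi : A -> 'rV[R]_k), proper_hom G phi >].
  have [k [G [phi h]]] := proper_hom_exists R A lcA.
  by exists k; apply/asboolP; exists G, phi.
case: (ex_minnP exk) => k /asboolP [G [phi Gphi]] kmin.
exists k, G, phi; split=> //.
have [oG D C0 P] := Gphi.
have small e : 0 < e -> forall r, (r <= k)%N -> exists B : 'M[R]_(r, k),
    row_free B /\ forall i, exists x, [/\ x \in G, `|phi x| < e & row i B = phi x].
  move=> e0; elim=> [|r IH] rk.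
    by exists 0; split; [rewrite /row_free mxrank0|case].
  have [B [Bfree Bsmall]] := IH (ltnW rk).
  have [[x [Gx xe xB]]|nex] := pselect (exists x, [/\ x \in G, `|phi x| < e & ~~ (phi x <= B)%MS]).
    rewrite -addn1; exists (col_mx B (phi x)); split.
      have : (B < col_mx B (phi x))%MS.
        by rewrite /ltmx col_mx_sub -addsmxE addsmxSl negb_and xB orbT.
      rewrite ltmxErank => /andP [_]; rewrite (eqP Bfree) => h.
      by rewrite /row_free eqn_leq rank_leq_row /= {1}addn1.
    move=> i; case: (split_ordP i) => j ->.
      by have [y [Gy ye yB]] := Bsmall j; exists y; split=> //; rewrite rowKu.
    by exists x; split=> //; rewrite rowKd ord1 row_id.
  have : (k <= r)%N.
    apply: kmin; apply/asboolP; apply: (proper_hom_reduce Gphi e0 (B := B)) => x Gx xe.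
    by apply: contrapT => /negP xB; apply: nex; exists x.
  by rewrite leqNgt rk.
apply: (proper_hom_onto_of_dense Gphi) => [|v e e0]; first by case: lcA.
have d0 : 0 < e / k.+1%:R by rewrite divr_gt0 // ltr0n.
have [B [Bfree Bsmall]] := small _ d0 k (leqnn k).
have {Bfree} Bunit : B \in unitmx by rewrite -row_free_unit.
have /choice [b bP] := Bsmall.
pose y := v *m invmx B.
have Gb i : b i *~ Num.floor (y 0 i) \in G.
  by case: (bP i) => Gbi _ _; rewrite rpredMz.
exists (\sum_i b i *~ Num.floor (y 0 i)); first exact: rpred_sum.
have -> : phi (\sum_i b i *~ Num.floor (y 0 i)) = \sum_i (Num.floor (y 0 i))%:~R *: row i B.
  suff h (s : seq 'I_k) : \sum_(i <- s) b i *~ Num.floor (y 0 i) \in G /\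
      phi (\sum_(i <- s) b i *~ Num.floor (y 0 i)) =
      \sum_(i <- s) (Num.floor (y 0 i))%:~R *: row i B by exact: (h _).2.
  elim: s => [|i s [IH1 IH2]]; first by rewrite !big_nil rpred0 (additive_on0 D).
  rewrite !big_cons; split; first exact: rpredD.
  rewrite D // IH2; congr (_ + _); case: (bP i) => Gbi _ ->.
  case: (Num.floor (y 0 i)) => n; first by rewrite -pmulrn (additive_onMn D) // scaler_nat.
  rewrite NegzE !mulrNz -pmulrn -[- _]sub0r (additive_onB D) ?rpred0 ?rpredMn //.
  by rewrite (additive_on0 D) (additive_onMn D) // sub0r scaleNr scaler_nat.
have {1}-> : v = \sum_i y 0 i *: row i B by rewrite -mulmx_sum_row mulmxKV.
rewrite -sumrB; apply: le_trans (ler_norm_sum _ _ _) _.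
apply: (@le_trans _ _ (\sum_(i < k) (e / k.+1%:R))).
  apply: ler_sum => i _; rewrite -scalerBl normrZ.
  have [_ bi ->] := bP i; rewrite -[leRHS]mul1r; apply: ler_pM => //; last exact: ltW.
  have /andP [h1 h2] := floor_itv (y 0 i); rewrite intrD in h2.
  by rewrite distrC ger0_norm; lra.
rewrite sumr_const card_ord -[_ *+ k]mulr_natr mulrAC ler_pdivrMr ?ltr0n // ler_pM2l //.
by rewrite ler_nat.
Qed.

(** * Divisible compact groups *)

(** Among [size s + 1] multiples of [x], two lie in the same coset. *)
Lemma finite_index_exponent {G : zmodType} {S : zmodClosed G} {s : seq G} :
  (forall x, exists2 y, y \in s & x - y \in S) ->
  exists2 N, (0 < N)%N & forall x, x *+ N \in S.
Proof.
move=> cov; exists (size s).+1`!; first exact: fact_gt0.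
move=> x; have /choice [y yP] : forall j : 'I_(size s).+1,
    exists i : 'I_(size s), x *+ j - s`_i \in S.
  move=> j; have [y ys xy] := cov (x *+ j).
  by rewrite -index_mem in ys; exists (Ordinal ys); rewrite nth_index // -index_mem.
have /injectivePn [j [j' ne eqy]] : ~~ injectiveb y.
  apply/negP => /injectiveP /leq_card; by rewrite !card_ord ltnn.
wlog lt : j j' ne eqy / (j < j')%N.
  move=> th; case: (ltngtP j j') => h; first exact: (th j j').
    by apply: (th j' j) => //; rewrite eq_sym.
  by case/eqP: ne; apply: val_inj.
have : x *+ (j' - j) \in S.
  rewrite mulrnBr; last exact: ltnW.
  have := rpredB (yP j') (yP j); rewrite eqy; congr (_ \in S); zmod.
have /dvdnP [t ->] : (j' - j %| (size s).+1`!)%N.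
  by apply: dvdn_fact; rewrite subn_gt0 lt /= leq_subLR (leq_trans (ltnW (ltn_ord j'))) // leq_addl.
by rewrite mulnC mulrnA => /rpredMn; apply.
Qed.

(** A clopen set is stable under an open subgroup. By compactness the latter has
    finite index, so a divisible group is equal to it. *)
Lemma divisible_compact_connected {X : topologicalZmodType} : compact [set: X] ->
  (forall n (x : X), (0 < n)%N -> exists y, x = y *+ n) -> connected [set: X].
Proof.
move=> cX divX B [b0 Bb0] [B1 oB]; rewrite setTI => EB; subst B1.
move=> [B1 clB]; rewrite setTI => EB; subst B1.
have cB : compact B by exact: (subclosed_compact clB cX).
have [Q QE] : exists Q : zmodClosed X,
    [set` Q] = [set x | forall b, B b -> B (b + x) /\ B (b - x)].
  apply: zmodClosed_of; first by move=> b Bb; rewrite /= subr0 addr0.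
  move=> x y hx hy b Bb; have [hx1 hx2] := hx b Bb.
  have [_ h1] := hy _ hx1; have [h2 _] := hy _ hx2.
  by rewrite opprB addrA; split=> //; rewrite addrCA addrC.
have QP x : x \in Q <-> (forall b, B b -> B (b + x) /\ B (b - x)).
  by change ([set` Q] x <-> (forall b, B b -> B (b + x) /\ B (b - x))); rewrite QE.
have W0 : nbhs (0 : X) [set w | forall b, B b -> B (b + w)].
  have := (iffLR (compact_near_coveringP B) cB) _ (nbhs (0 : X)) (fun w b => B (b + w)) _.
  apply => b Bb; have := @add_continuous X (b, 0); rewrite /continuous_at /= addr0.
  by move: oB; rewrite openE => /(_ b Bb) Bb' /(_ _ Bb').
have oQ : open [set` Q].
  apply: sub_nbhs_open (filterI W0 (nbhs0_opp _ W0)) _ => x [/= h1 h2].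
  by apply/QP => b Bb; split; [exact: h1|exact: h2].
have Q0 : nbhs (0 : X) [set` Q] by move: oQ; rewrite openE => /(_ 0 (rpred0 Q)).
have [s sX] := compact_translates _ _ cX Q0.
have [N N0 hN] := finite_index_exponent (fun x => sX x I).
apply/seteqP; split=> // x _; have [y xy] := divX N (x - b0) N0.
have /QP /(_ b0 Bb0) [] := hN y.
by rewrite -xy addrC subrK.
Qed.

Section SubgroupTopology.
Context {A : topologicalZmodType} (S : zmodClosed A).

Lemma nbhs_subgroup (x : subgroup S) (U : set (subgroup S)) :
  nbhs x U <-> exists2 V, nbhs (val x) V & val @^-1` V `<=` U.
Proof.
split=> [|[V Vx VU]]; last first.
  by apply: filterS VU _; exact: subgroup_val_continuous.
rewrite nbhsE => -[W [[V oV VW] Wx] WU].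
exists V; last by rewrite VW.
by move: oV; rewrite openE; apply; rewrite -VW in Wx.
Qed.

Lemma compact_subgroup_preimage (K : set A) : compact K -> K `<=` [set` S] ->
  compact (val @^-1` K : set (subgroup S)).
Proof.
move=> cK KS F FF FK.
have [x [Kx clx]] := cK (val @ F) _ FK.
have [s sx] : exists s : subgroup S, val s = x by exists (Sub x (KS x Kx)); rewrite SubK.
exists s; split; first by rewrite /= sx.
move=> P Q FP /nbhs_subgroup [V Vs VQ]; rewrite sx in Vs.
have [|y [/= [p Pp <-] Vp]] := clx (val @` P) V _ Vs.
  by apply: (@filterS _ F _ P) => // p Pp; exists p.
by exists p; split=> //; exact: VQ.
Qed.

Lemma subgroup_hausdorff : hausdorff_space A -> hausdorff_space (subgroup S).
Proof.
move=> hA; apply: nbhs0_hausdorff => x hx; apply: val_inj; rewrite raddf0.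
apply: (hausdorff_nbhs0 _ hA) => W W0; apply: (hx (val @^-1` W)).
by apply/nbhs_subgroup; exists W; rewrite ?raddf0.
Qed.

Lemma subgroup_LCA : closed [set` S] -> LCA A -> LCA (subgroup S).
Proof.
move=> clS lcA; have [K K0 cK] := LCA_nbhs lcA.
have cKS : compact (K `&` [set` S]) by exact: compact_closedI.
apply: (nbhs_LCA _ (subgroup_hausdorff lcA.1) _ (compact_subgroup_preimage _ cKS _)).
  apply/nbhs_subgroup; exists K; rewrite ?raddf0 // => x Kx; split=> //; exact: (valP x).
by move=> x [].
Qed.

Lemma subgroup_compact : compact [set` S] -> compact [set: subgroup S].
Proof.
move=> cS; rewrite (_ : [set: _] = val @^-1` [set` S]).
  exact: compact_subgroup_preimage.
by apply/seteqP; split=> // x _; exact: (valP x).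
Qed.
End SubgroupTopology.

(** The subgroup is the intersection of the [n! C]. Compactness makes it
    divisible, hence connected. *)
Lemma compact_divisible_core {A : topologicalZmodType} (C : zmodClosed A) :
  hausdorff_space A -> compact [set` C] ->
  exists S : zmodClosed A, [/\ {subset S <= C}, closed [set` S], type_S1 (subgroup S)
    & forall U, open U -> [set` S] `<=` U ->
        exists n, [set x *+ n`! | x in [set` C]] `<=` U].
Proof.
move=> hA cC.
pose D n := [set x *+ n`! | x in [set` C]].
have cD n : compact (D n) by exact: compact_muln.
have clD n : closed (D n) by exact: compact_closed.
have DS n : D n.+1 `<=` D n.
  move=> _ [x Cx <-]; exists (x *+ n.+1); first exact: rpredMn.
  by rewrite -mulrnA factS.
have DC n : D n `<=` [set` C] by move=> _ [x Cx <-]; exact: rpredMn.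
have [S SE] : exists S : zmodClosed A, [set` S] = \bigcap_n D n.
  apply: zmodClosed_of; first by move=> n _; exists 0; [exact: rpred0|rewrite mul0rn].
  move=> x y hx hy n _; have [a Ca <-] := hx n I; have [b Cb <-] := hy n I.
  by exists (a - b); [exact: rpredB|rewrite mulrnBl].
have SP x : x \in S <-> forall n, D n x.
  change ([set` S] x <-> forall n, D n x); rewrite SE.
  by split=> [h n|h n _]; exact: h.
have clS : closed [set` S] by rewrite SE; apply: closed_bigI.
have SC : {subset S <= C} by move=> x /SP /(_ 0%N) /DC.
have cS : compact [set` S] by apply: (subclosed_compact clS cC) => x /SC.
have lS : LCA (subgroup S).
  apply: (nbhs_LCA _ (subgroup_hausdorff S hA) _ (subgroup_compact S cS)).
  exact: filterT.
exists S; split=> //.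
  split=> //; first exact: subgroup_compact.
  apply: divisible_compact_connected; first exact: subgroup_compact.
  move=> n x n0; have Sx : val x \in S by exact: (valP x).
  pose E m := D m `&` [set y | y *+ n = val x].
  have clE m : closed (E m).
    apply: closedI => //; rewrite (_ : mkset _ = (fun y => y *+ n) @^-1` [set val x]) //.
    apply: closed_comp; first by move=> y _; exact: mulrn_continuous.
    by apply: compact_closed => //; exact: compact_set1.
  have [|||y yE] := nested_compact cC clE.
  - by move=> m y [/DS ? ?].
  - move=> m; have [c Cc cx] := iffLR (SP _) Sx (n + m)%N.
    have /dvdnP [t tE] : (n * m`! %| (n + m)`!)%N.
      apply: (@dvdn_trans (n`! * m`!)).
        by apply: dvdn_mul => //; apply: dvdn_fact; rewrite n0 leqnn.
      by rewrite -(bin_fact (leq_addr m n)) addKn dvdn_mull.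
    exists (c *+ t *+ m`!); split; first by exists (c *+ t) => //; exact: rpredMn.
    by rewrite /= -!mulrnA -cx tE mulnA mulnAC -mulnA (mulnC n).
  - by move=> y [/DC].
  have Sy : y \in S by apply/SP => m; case: (yE m).
  exists (Sub y Sy); apply: val_inj; rewrite raddfMn.
  by case: (yE 0%N) => _ <-.
move=> U oU SU; apply: (nested_compact_sub cC clD DS (DC 0%N) oU) => x Dx.
by apply: SU; apply/SP.
Qed.

(** * Splitting off a real vector space *)

Lemma dvdn_fact2 a b n : (0 < a)%N -> (0 < b)%N -> (a + b <= n)%N -> (a * b %| n`!)%N.
Proof.
move=> a0 b0 abn; apply: (@dvdn_trans (a`! * b`!)).
  by apply: dvdn_mul; apply: dvdn_fact; rewrite ?a0 ?b0 leqnn.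
apply: (@dvdn_trans (a + b)`!); last first.
  have /subnK <- := abn; rewrite -(bin_fact (leq_addl (n - (a + b)) (a + b))) addnK.
  by rewrite mulnCA dvdn_mulr.
by rewrite -(bin_fact (leq_addr b a)) addKn dvdn_mull.
Qed.

(** Modulo the subgroup [H], on which [p] has compact fibres, [E] is torsion.
    The last hypothesis retains of the profiniteness of the kernel of [p] on [H]
    that [n!] tends to [0] uniformly on it. *)
Section Splitting.
Context {R : realType} {E : topologicalZmodType} {k : nat}.
Variables (p : {additive E -> 'rV[R]_k}) (H : zmodClosed E).
Hypothesis lcE : LCA E.
Hypothesis cp : continuous p.
Hypothesis Htors : forall x, exists2 m, (0 < m)%N & x *+ m \in H.
Hypothesis Honto : forall v, exists2 x, x \in H & p x = v.
Hypothesis Hfiber : forall v, compact [set x | x \in H /\ p x = v].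
Hypothesis Hopen : forall W, nbhs (0 : E) W -> exists2 d : R, 0 < d &
  forall x, x \in H -> `|p x| < d -> exists y, [/\ y \in H, p y = 0 & W (x - y)].
Hypothesis Hprofinite : forall W, nbhs (0 : E) W -> exists2 n, (0 < n)%N &
  forall x, x \in H -> p x = 0 -> W (x *+ n).

Let divisible x := forall n, exists2 e, e \in H & x = e *+ n`!.

Let divisibleB x y : divisible x -> divisible y -> divisible (x - y).
Proof.
move=> hx hy n; have [e He ->] := hx n; have [e' He' ->] := hy n.
by exists (e - e'); [exact: rpredB|rewrite mulrnBl].
Qed.

Let rVMn0 (v : 'rV[R]_k) n : (0 < n)%N -> v *+ n = 0 -> v = 0.
Proof.
move=> n0 /eqP; rewrite -scaler_nat scaler_eq0 pnatr_eq0 => /orP [/eqP n00|/eqP //].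
by rewrite n00 in n0.
Qed.

Let divisible_ker x : divisible x -> p x = 0 -> x = 0.
Proof.
move=> hx px; apply: (hausdorff_nbhs0 _ lcE.1) => W /Hprofinite [n n0 hn].
have [e He xe] := hx n.
have pe : p e = 0.
  by apply: (rVMn0 _ n`!); [exact: fact_gt0|rewrite -raddfMn -xe].
have /dvdnP [t tE] : (n %| n`!)%N by apply: dvdn_fact; rewrite n0 leqnn.
rewrite xe tE mulrnA; apply: hn; first exact: rpredMn.
by rewrite raddfMn pe mul0rn.
Qed.

Let section_exists v : exists x, divisible x /\ p x = v.
Proof.
pose C n := [set e *+ n`! | e in [set e | e \in H /\ p e = n`!%:R^-1 *: v]].
have n0 n : n`!%:R != 0 :> R by rewrite pnatr_eq0 -lt0n fact_gt0.
have cC n : compact (C n) by exact: compact_muln.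
have Cn n : C n.+1 `<=` C n.
  move=> _ [e [He pe] <-]; exists (e *+ n.+1); last by rewrite -mulrnA factS.
  split; first exact: rpredMn.
  rewrite raddfMn pe -scaler_nat scalerA factS natrM invfM mulrA mulfV ?mul1r ?pnatr_eq0 //.
have [||||x xP] := nested_compact (cC 0%N) (C := C).
- by move=> n; apply: compact_closed; [exact: lcE.1|exact: cC].
- exact: Cn.
- by move=> n; have [e He pe] := Honto (n`!%:R^-1 *: v); exists (e *+ n`!), e.
- by [].
exists x; split.
  by move=> n; have [e [He _] <-] := xP n; exists e.
by have [e [_ pe] <-] := xP 0%N; rewrite mulr1n pe invr1 scale1r.
Qed.

(** Multiples by [n!] of lifts of [v / n!] converge, because the ambiguity of
    the lift dies in the limit; this is the splitting. *)
Lemma real_section : exists s : {additive 'rV[R]_k -> E},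
  continuous s /\ forall v, p (s v) = v.
Proof.
have /choice [f fP] := section_exists.
have [s sE] : exists s : {additive 'rV[R]_k -> E}, (s : 'rV[R]_k -> E) = f.
  apply: additive_of => v w; apply/eqP; rewrite -subr_eq0; apply/eqP/divisible_ker.
    by apply: divisibleB; [|apply: divisibleB]; exact: (fP _).1.
  by rewrite !(raddfB p) !(fP _).2 subrr.
have sP v : divisible (s v) /\ p (s v) = v by rewrite sE.
exists s; split; last by move=> v; case: (sP v).
apply: additive_continuous => W W0; have [V [V0 VN VW]] := nbhs0_half _ W0.
have [n n0 hn] := Hprofinite _ V0.
have Vn : nbhs (0 : E) [set x | V (x *+ n)].
  by have := @mulrn_continuous E n 0; rewrite /continuous_at mul0rn => /(_ _ V0).
have [d d0 hd] := Hopen _ Vn.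
have := @nbhs0_lt R 'rV[R]_k d d0.
apply: filterS => v vd; have [hdiv psv] := sP v.
have [e He ve] := hdiv n.
have /dvdnP [t tE] : (n %| n`!)%N by apply: dvdn_fact; rewrite n0 leqnn.
have He' : e *+ t \in H by exact: rpredMn.
have pe' : p (e *+ t) *+ n = v by rewrite -raddfMn -mulrnA -tE -ve.
have [|y [Hy py Vy]] := hd _ He'.
  apply: le_lt_trans vd; rewrite /= -pe' normrMn -mulr_natr ler_peMr //.
  by rewrite ler1n.
rewrite /= ve tE mulrnA -(subrK y (e *+ t)) mulrnDl; apply: VW => //.
exact: hn.
Qed.

(** Some multiple of an element of the kernel lies in [H], where [n!] tends to
    [0]. *)
Lemma ker_topological_torsion (T : zmodClosed E) :
  [set` T] = [set x | p x = 0] -> topological_torsion (subgroup T).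
Proof.
move=> TE; have TP x : x \in T <-> p x = 0.
  by change ([set` T] x <-> p x = 0); rewrite TE.
split.
  apply: subgroup_LCA => //; rewrite TE (_ : mkset _ = p @^-1` [set 0]) //.
  apply: closed_comp; first by move=> y _; exact: cp.
  apply: compact_closed; first exact: norm_hausdorff.
  exact: compact_set1.
move=> a W /nbhs_subgroup [V]; rewrite raddf0 => V0 VW.
have [m m0 Hm] := Htors (val a).
have [n0 n00 hn0] := Hprofinite _ V0.
exists (m + n0)%N => // n /= mn; apply: VW => /=.
have -> : val (a *+ n`!) = val a *+ n`! by exact: raddfMn.
have /dvdnP [t ->] := dvdn_fact2 _ _ _ m0 n00 mn.
rewrite (_ : _ *+ _ = val a *+ m *+ t *+ n0); last by rewrite -!mulrnA; congr (_ *+ _); lia.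
apply: hn0; first by rewrite rpredMn.
by rewrite !raddfMn (iffLR (TP _) (valP a)) !mul0rn.
Qed.

Lemma split_type_A : type_A R E.
Proof.
split=> //.
have [s [cs ps]] := real_section.
have [T TE] : exists T : zmodClosed E, [set` T] = [set x | p x = 0].
  apply: zmodClosed_of; first exact: raddf0.
  by move=> x y /= px py; rewrite raddfB px py subrr.
have TP x : p x = 0 -> x \in T by move=> px; have : [set` T] x by rewrite TE.
have PT x : x \in T -> p x = 0 by move=> Tx; have : [set` T] x by []; rewrite TE.
exists ('rV[R]_k : topologicalZmodType), (subgroup T : topologicalZmodType).
split; first by exists k, idfun, id; split=> // x; exact: cvg_id.
  exact: ker_topological_torsion.
have Tsub x : x - s (p x) \in T by apply: TP; rewrite raddfB ps subrr.
pose t x : subgroup T := Sub (x - s (p x)) (Tsub x).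
have tE x : val (t x) = x - s (p x) by [].
have tB x y : t (x - y) = t x - t y.
  apply: val_inj; have -> : val (t x - t y) = val (t x) - val (t y) by exact: raddfB.
  by rewrite !tE (raddfB p) (raddfB s); zmod.
have ct : continuous t.
  apply: continuous_comp_initial => y.
  apply: (@continuous_comp _ _ _ (fun y : E => (y, s (p y))) (fun q : E * E => q.1 - q.2)).
    apply: cvg_pair; first exact: cvg_id.
    by apply: (@continuous_comp _ _ _ p s); [exact: cp|exact: cs].
  exact: sub_continuous.
have [f fE] : exists f : {additive E -> prod_group 'rV[R]_k (subgroup T)},
    (f : E -> prod_group 'rV[R]_k (subgroup T)) = (fun x => (p x, t x)).
  by apply: additive_of => x y; rewrite tB raddfB.
exists f, (fun z => s z.1 + val z.2); split.
- by move=> x; rewrite fE /= addrC subrK.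
- move=> [v u]; rewrite fE /=.
  have pv : p (s v + val u) = v by rewrite raddfD ps (PT _ (valP u)) addr0.
  by congr pair => //; apply: val_inj; rewrite tE pv addrC addKr.
- by rewrite fE; exact: (pair_continuous cp ct).
- apply: (@add_fun_continuous (prod_group 'rV[R]_k (subgroup T)) E (s \o fst) (val \o snd)).
    by move=> z; apply: continuous_comp; [exact: cvg_fst|exact: cs].
  by move=> z; apply: continuous_comp; [exact: cvg_snd|exact: subgroup_val_continuous].
Qed.
End Splitting.

(** * Quotient groups *)

Section Quotient.
Context {A : topologicalZmodType} (S : zmodClosed A).

(** A constant for the projection, as a carrier for its additive structure. *)
Definition quo (x : A) : quotient_group S := \pi_(Quotient.quot S)%qT x.

Lemma quoB : {morph quo : x y / x - y}.
Proof. exact: quotient_group_piB. Qed.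

HB.instance Definition _ := GRing.isZmodMorphism.Build A (quotient_group S) quo quoB.

Lemma quo_surj q : exists x, quo x = q.
Proof. by exists (repr q); exact: reprK. Qed.

Lemma quo_eq x y : quo x = quo y <-> x - y \in S.
Proof. exact: quotient_group_piP. Qed.

Lemma quo_eq0 x : quo x = 0 <-> x \in S.
Proof. by rewrite -(raddf0 quo) quo_eq subr0. Qed.

Lemma quo_continuous : continuous quo.
Proof. exact: quotient_group_pi_continuous. Qed.

Lemma quo_nbhs0 W : nbhs (0 : quotient_group S) W -> nbhs (0 : A) [set x | W (quo x)].
Proof. by rewrite -(raddf0 quo) => /quo_continuous. Qed.

Lemma quo_image_nbhs0 W : nbhs (0 : A) W -> nbhs (0 : quotient_group S) (quo @` W).
Proof. by rewrite -(raddf0 quo); exact: quotient_group_pi_nbhs. Qed.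

Lemma quo_compact K : compact K -> compact (quo @` K).
Proof.
by move=> cK; apply: continuous_compact => //; apply: continuous_subspaceT; exact: quo_continuous.
Qed.

Lemma quotient_hausdorff : closed [set` S] -> hausdorff_space (quotient_group S).
Proof.
move=> clS; apply: nbhs0_hausdorff => q; have [x <-] := quo_surj q => hx.
apply/quo_eq0; apply: contrapT => nSx.
have [V V0 Vx] := closed_nbhs0 _ _ clS nSx.
have [v Vv /esym /quo_eq Sxv] := hx _ (quo_image_nbhs0 _ (nbhs0_opp _ V0)).
exact: (Vx (- v)).
Qed.

Lemma quotient_LCA : closed [set` S] -> LCA A -> LCA (quotient_group S).
Proof.
move=> clS /LCA_nbhs [K K0 cK].
exact: (nbhs_LCA _ (quotient_hausdorff clS) (quo_image_nbhs0 _ K0) (quo_compact _ cK)).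
Qed.

Lemma quotient_factor {B : topologicalZmodType} (f : {additive A -> B}) :
  continuous f -> (forall x, x \in S -> f x = 0) ->
  exists2 g : {additive quotient_group S -> B}, continuous g & forall x, g (quo x) = f x.
Proof.
move=> cf f0; pose h (q : quotient_group S) := f (repr q).
have hE x : h (quo x) = f x.
  apply/eqP; rewrite -subr_eq0 -raddfB; apply/eqP/f0/quo_eq; exact: reprK.
have [g gE] : exists g : {additive quotient_group S -> B}, (g : quotient_group S -> B) = h.
  apply: additive_of => a b; have [x <-] := quo_surj a; have [y <-] := quo_surj b.
  by rewrite -raddfB !hE raddfB.
exists g; last by move=> x; rewrite gE hE.
apply: additive_continuous => W W0.
have : nbhs (0 : A) (f @^-1` W) by apply: cf; rewrite raddf0.
move=> /quo_image_nbhs0; apply: filterS => _ [x Wx <-] /=.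
by rewrite gE hE.
Qed.

Lemma open_quotient_discrete : open [set` S] -> discrete (quotient_group S).
Proof.
move=> oS U; have S0 : nbhs (0 : A) [set` S] by move: oS; rewrite openE => /(_ 0 (rpred0 S)).
rewrite openE => q Uq; apply/nbhs_shift; apply: filterS (quo_image_nbhs0 _ S0).
by move=> _ [s Ss <-] /=; rewrite (iffRL (quo_eq0 s) Ss) addr0.
Qed.
End Quotient.

Lemma discrete_LCA {A : topologicalZmodType} : discrete A -> LCA A.
Proof.
move=> dA; have nb : nbhs (0 : A) [set 0] by have := dA [set 0]; rewrite openE; apply.
apply: (nbhs_LCA [set 0]) => //; last exact: compact_set1.
by apply: nbhs0_hausdorff => x /(_ _ nb).
Qed.

(** * Existence of the chain *)

Section Existence.
Context {R : realType} {A : topologicalZmodType} {k : nat}.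
Context {G : zmodClosed A} {phi : A -> 'rV[R]_k}.
Hypothesis lcA : LCA A.
Hypothesis Gphi : proper_hom G phi.

Let phiD : {in G &, {morph phi : x y / x + y}}. Proof. by case: Gphi. Qed.

Lemma proper_hom_ker : exists C : zmodClosed A,
  [set` C] = [set x | x \in G /\ phi x = 0] /\ compact [set` C].
Proof.
have [C CE] : exists C : zmodClosed A, [set` C] = [set x | x \in G /\ phi x = 0].
  apply: zmodClosed_of; first by rewrite /= rpred0 (additive_on0 phiD).
  move=> x y [Gx px] [Gy py] /=; split; first exact: rpredB.
  by rewrite (additive_onB phiD) // px py subrr.
exists C; split=> //.
rewrite CE (_ : mkset _ = [set x | x \in G /\ `|phi x - 0| <= 0]); first exact: (proper_hom_compact Gphi).
by apply/seteqP; split=> x /=; rewrite subr0 normr_le0 => -[Gx /eqP].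
Qed.

(** The compact sets where [|phi| <= 1 / n] shrink to the kernel, so they end up
    in its neighbourhood [ker phi + W]. *)
Lemma proper_hom_open W : nbhs (0 : A) W -> exists2 d : R, 0 < d &
  forall x, x \in G -> `|phi x| < d -> exists y, [/\ y \in G, phi y = 0 & W (x - y)].
Proof.
move=> W0; pose C n := [set x | x \in G /\ `|phi x - 0| <= n.+1%:R^-1].
have cC n : compact (C n) by exact: (proper_hom_compact Gphi).
pose U := \bigcup_(y in [set y | y \in G /\ phi y = 0]) ((fun x => - y + x) @^-1` W°).
have oU : open U.
  apply: bigcup_open => y _; apply: open_comp; last exact: open_interior.
  by move=> x _; exact: shift_continuous.
have [|||||n CU] := nested_compact_sub (cC 0%N) (C := C) (U := U) => //.
- by move=> n; apply: compact_closed => //; case: lcA.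
- move=> n x [Gx xn]; split=> //; apply: le_trans xn _.
  by rewrite lef_pV2 ?posrE ?ltr0n // ler_nat.
- move=> x xC; have Gx : x \in G by case: (xC 0%N).
  exists x; last by rewrite /= addNr; exact: W0.
  split=> //; apply/eqP; rewrite -normr_eq0 eq_le normr_ge0 andbT.
  apply/ler_addgt0Pr => e e0; rewrite add0r.
  have [_ ] := xC (Num.bound e^-1); rewrite subr0 => /le_trans; apply.
  rewrite -[leRHS]invrK lef_pV2 ?posrE ?invr_gt0 ?ltr0n //.
  apply: ltW; apply: lt_trans (archi_boundP _) _; first by rewrite invr_ge0 ltW.
  by rewrite ltr_nat.
exists n.+1%:R^-1; first by rewrite invr_gt0 ltr0n.
move=> x Gx xn; have [|y [Gy py] yx] := CU x; first by split; rewrite // subr0 ltW.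
by exists y; split=> //; rewrite addrC; exact: interior_subset.
Qed.

(** The elements some multiple of which lies in [G]: the target being
    divisible and torsion free, [phi] extends uniquely to them. *)
Lemma torsion_saturation : exists (F : zmodClosed A) (Phi : A -> 'rV[R]_k),
  [/\ forall x, x \in F <-> exists2 m, (0 < m)%N & x *+ m \in G,
      {in F &, {morph Phi : x y / x - y}} & {in G, Phi =1 phi}].
Proof.
have [F FE] : exists F : zmodClosed A, [set` F] = [set x | exists2 m, (0 < m)%N & x *+ m \in G].
  apply: zmodClosed_of; first by exists 1%N; rewrite ?mul0rn ?rpred0.
  move=> x y [m m0 Gx] [n n0 Gy]; exists (m * n)%N; first by rewrite muln_gt0 m0.
  by rewrite mulrnBl mulrnA (mulnC m) [y *+ _]mulrnA rpredB // rpredMn.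
have FP x : x \in F <-> exists2 m, (0 < m)%N & x *+ m \in G.
  by change ([set` F] x <-> exists2 m, (0 < m)%N & x *+ m \in G); rewrite FE.
have /choice [m mP] : forall x, exists m, x \in F -> (0 < m)%N /\ x *+ m \in G.
  move=> x; have [/FP [m m0 Gx]|_] := boolP (x \in F); last by exists 0%N.
  by exists m.
pose Phi x := (m x)%:R^-1 *: phi (x *+ m x).
have PhiE x n : (0 < n)%N -> x *+ n \in G -> Phi x = n%:R^-1 *: phi (x *+ n).
  move=> n0 Gx; have Fx : x \in F by apply/FP; exists n.
  have [m0 Gmx] := mP x Fx; rewrite /Phi.
  have nR j : (0 < j)%N -> j%:R != 0 :> R by rewrite pnatr_eq0 -lt0n.
  apply: (scalerI (nR _ m0)); apply: (scalerI (nR _ n0)).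
  rewrite !scalerA mulfK ?nR // (mulrC n%:R) mulfK ?nR //.
  rewrite !scaler_nat -!(additive_onMn phiD) // -!mulrnA; congr phi.
  by rewrite mulnC.
exists F, Phi; split=> //; last by move=> x Gx; rewrite (PhiE x 1%N) // mulr1n invr1 scale1r.
move=> x y Fx Fy.
have [m0 Gx] := mP x Fx; have [n0 Gy] := mP y Fy.
have mn0 : (0 < m x * m y)%N by rewrite muln_gt0 m0.
have Gx' : x *+ (m x * m y) \in G by rewrite mulrnA rpredMn.
have Gy' : y *+ (m x * m y) \in G by rewrite mulnC mulrnA rpredMn.
have Gxy : (x - y) *+ (m x * m y) \in G by rewrite mulrnBl rpredB.
by rewrite !(PhiE _ _ mn0) // mulrnBl (additive_onB phiD) // scalerBr.
Qed.
End Existence.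

Lemma canonical_chain_exists (R : realType) (A : topologicalZmodType) : LCA A ->
  exists SF : zmodClosed A * zmodClosed A, is_canonical_chain R SF.1 SF.2.
Proof.
move=> lcA; have [k [G [phi [Gphi Gonto]]]] := proper_hom_onto R A lcA.
have [oG phiD phi0 _] := Gphi.
have [C [CE cC]] := proper_hom_ker Gphi.
have CP x : x \in C <-> x \in G /\ phi x = 0.
  by change ([set` C] x <-> x \in G /\ phi x = 0); rewrite CE.
have [S [SC clS tS Score]] := compact_divisible_core C lcA.1 cC.
have [F [Phi [FP PhiB Phiphi]]] := torsion_saturation Gphi.
have GF : {subset G <= F} by move=> x Gx; apply/FP; exists 1%N.
have SG x : x \in S -> x \in G /\ phi x = 0 by move=> /SC /CP.
have G0 : nbhs (0 : A) [set` G] by move: oG; rewrite openE => /(_ 0 (rpred0 G)).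
have oF : open [set` F] by exact: sub_nbhs_open G0 GF.
have clF : closed [set` F] by exact: open_subgroup_closed.
exists (S, F) => /=; split=> //; first by move=> x /SG [/GF].
  have [P PE] : exists P : {additive subgroup F -> 'rV[R]_k},
      (P : subgroup F -> 'rV[R]_k) = Phi \o val.
    apply: additive_of => x y /=; rewrite -PhiB; try exact: valP.
    by congr Phi; exact: raddfB.
  have cP : continuous P.
    apply: additive_continuous => W W0; apply/nbhs_subgroup; rewrite raddf0.
    have [e /= e0 eW] := iffLR (nbhs_ballP _ _) W0.
    exists [set x | x \in G /\ `|phi x| < e]; first exact: phi0.
    move=> x [/= Gx xe]; rewrite PE /= Phiphi //; apply: eW.
    by rewrite -ball_normE /= sub0r normrN.
  pose S' := subgroup_in F S.
  have S'P (x : subgroup F) : x \in S' <-> val x \in S by [].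
  have clS' : closed [set` S'].
    rewrite (_ : [set` _] = val @^-1` [set` S]) //.
    by apply: closed_comp => // x _; exact: subgroup_val_continuous.
  have [p cp pE] : exists2 p : {additive subquotient F S -> 'rV[R]_k}, continuous p &
      forall x, p (quo S' x) = P x.
    apply: quotient_factor => // x /S'P /SG [Gx px].
    by rewrite PE /= Phiphi.
  have [H HE] : exists H : zmodClosed (subquotient F S),
      [set` H] = quo S' @` [set x | val x \in G].
    apply: zmodClosed_of; first by exists 0; [exact: (rpred0 G)|exact: raddf0].
    move=> _ _ [x Gx <-] [y Gy <-]; exists (x - y); last exact: raddfB.
    exact: (rpredB Gx Gy).
  have HP q : q \in H <-> exists2 x, val x \in G & quo S' x = q.
    by change ([set` H] q <-> exists2 x, val x \in G & quo S' x = q); rewrite HE.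
  have lift x : x \in G -> exists2 y : subgroup F, val y = x & True.
    by move=> /GF Fx; exists (Sub x Fx); rewrite ?SubK.
  have pG y : val y \in G -> p (quo S' y) = phi (val y).
    by move=> Gy; rewrite pE PE /= Phiphi.
  have lowW W : nbhs (0 : subquotient F S) W -> exists2 V, nbhs (0 : A) V &
      forall y, V (val y) -> W (quo S' y).
    by move=> /quo_nbhs0 /nbhs_subgroup [V]; rewrite raddf0 => V0 VW; exists V.
  apply: (split_type_A p H) => //.
  - exact: (quotient_LCA _ clS' (subgroup_LCA _ clF lcA)).
  - move=> q; have [x <-] := quo_surj _ q.
    have /FP [m m0 Gm] := valP x; exists m => //; apply/HP; exists (x *+ m); last exact: raddfMn.
    by have -> : val (x *+ m) = val x *+ m by exact: raddfMn.
  - move=> v; have [x Gx xv] := Gonto v; have [y yx _] := lift x Gx.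
    exists (quo S' y); first by apply/HP; exists y; rewrite ?yx.
    by rewrite pG ?yx.
  - move=> v; rewrite (_ : mkset _ = quo S' @` (val @^-1` [set x | x \in G /\ `|phi x - v| <= 0])).
      apply: quo_compact; apply: compact_subgroup_preimage; first exact: (proper_hom_compact Gphi).
      by move=> x [/GF].
    apply/seteqP; split=> [q [/HP [x Gx <-] px]|_ [x [/= Gx px] <-]].
      by exists x => //; split=> //; rewrite -pG // px subrr normr0.
    split; first by apply/HP; exists x.
    by rewrite pG //; apply/eqP; rewrite -subr_eq0 -normr_le0.
  - move=> W /lowW [V V0 VW]; have [d d0 hd] := proper_hom_open lcA Gphi _ V0.
    exists d => // q /HP [x Gx <-]; rewrite pG // => /(hd _ Gx) [y [Gy py Vy]].
    have [z zy _] := lift y Gy.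
    exists (quo S' z); split; first by apply/HP; exists z; rewrite ?zy.
      by rewrite pG ?zy.
    rewrite -raddfB; apply: VW.
    by have -> : val (x - z) = val x - val z by [exact: raddfB]; rewrite zy.
  - move=> W /lowW [V V0 VW].
    pose U := \bigcup_(y in [set` S]) ((fun x => - y + x) @^-1` V°).
    have oU : open U.
      apply: bigcup_open => y _; apply: open_comp; last exact: open_interior.
      by move=> x _; exact: shift_continuous.
    have [|n hn] := Score U oU.
      by move=> x Sx; exists x => //=; rewrite addNr; exact: V0.
    exists n`!; first exact: fact_gt0.
    move=> q /HP [x Gx <-]; rewrite pG // => px.
    have [|s Ss Vs] := hn (val x *+ n`!).
      by exists (val x) => //; apply/CP.
    have [s' s's _] := lift s (SG s Ss).1.
    have -> : quo S' x *+ n`! = quo S' (x *+ n`! - s').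
      have s'0 : quo S' s' = 0 by apply/quo_eq0/S'P; rewrite s's.
      have -> : quo S' (x *+ n`! - s') = quo S' (x *+ n`!) - quo S' s' by exact: raddfB.
      by rewrite s'0 subr0; apply: esym; exact: raddfMn.
    apply: VW; have -> : val (x *+ n`! - s') = val x *+ n`! - val s'.
      by rewrite -raddfMn; exact: raddfB.
    by rewrite s's addrC; exact: interior_subset.
have dF := open_quotient_discrete F oF.
split=> //; first exact: discrete_LCA.
move=> q n n0; have [x <-] := quo_surj _ q.
rewrite -raddfMn => /quo_eq0 /FP [m m0 Gm]; apply/quo_eq0/FP.
by exists (n * m)%N; rewrite ?muln_gt0 ?n0 // mulrnA.
Qed.

(** * Connected compact groups are divisible *)

(** [f] selects a maximal independent family of rows of [M], on which the image
    of any vector can be expressed. *)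
Lemma mod_annihilator (F : fieldType) n m (M : 'M[F]_(n, m)) :
  exists r (f : 'I_r -> 'I_n), (r <= m)%N /\
    forall z : 'rV[F]_n, exists y : 'I_r -> F,
      (z - \sum_j y j *: delta_mx 0 (f j)) *m M = 0.
Proof.
exists (\rank M), (maxrankfun M); split; first exact: rank_leq_col.
move=> z; have /submxP [y yE] : (z *m M <= rowsub (maxrankfun M) M)%MS.
  by rewrite eq_maxrowsub submxMl.
exists (y 0); rewrite mulmxBl mulmx_suml yE mulmx_sum_row; apply/eqP.
rewrite subr_eq0; apply/eqP; apply: eq_bigr => j _.
by rewrite -scalemxAl -rowE; congr (_ *: _); apply/rowP => l; rewrite !mxE.
Qed.

Section ElementarySum.
Context {X : zmodType} {p n : nat} (p_pr : prime p) (Xp : forall x : X, x *+ p = 0).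
Variable v : 'I_n -> X.

(** The coefficients are read as natural numbers below [p], which is harmless as
    [p] kills [X]. *)
Definition Fp_comb (z : 'rV['F_p]_n) : X := \sum_i v i *+ (z 0 i : nat).

Lemma mulrn_mod (x : X) m : x *+ (m %% p) = x *+ m.
Proof. by rewrite {2}(divn_eq m p) mulrnDr mulnC mulrnA Xp mul0rn add0r. Qed.

Lemma Fp_combD : {morph Fp_comb : x y / x + y}.
Proof.
move=> x y; rewrite /Fp_comb -big_split /=; apply: eq_bigr => i _; rewrite mxE -mulrnDr.
rewrite -[RHS]mulrn_mod /=; congr (_ *+ _).
by rewrite [X in (_ %% X)%N](Fp_cast p_pr).
Qed.

Lemma Fp_combB : {morph Fp_comb : x y / x - y}.
Proof.
by move=> x y; apply: (addIr (Fp_comb y)); rewrite -Fp_combD !subrK.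
Qed.

Lemma Fp_comb_delta (c : 'F_p) i : Fp_comb (c *: delta_mx 0 i) = v i *+ (c : nat).
Proof.
rewrite /Fp_comb (bigD1 i) //= !mxE !eqxx mulr1 big1 ?addr0 // => j ji.
by rewrite !mxE (negbTE ji) andbF mulr0 mulr0n.
Qed.

Lemma Fp_comb_sum r (f : 'I_r -> 'I_n) (y : 'I_r -> 'F_p) :
  Fp_comb (\sum_j y j *: delta_mx 0 (f j)) = \sum_j v (f j) *+ (y j : nat).
Proof.
rewrite (big_morph _ Fp_combD (_ : Fp_comb 0 = 0)).
  by apply: eq_bigr => j _; rewrite Fp_comb_delta.
by apply: (addIr (Fp_comb 0)); rewrite -Fp_combD !add0r.
Qed.
End ElementarySum.

Section Connected.
Context {X : topologicalZmodType}.
Hypotheses (cX : compact [set: X]) (connX : connected [set: X]).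

Lemma connected_generated (V : set X) : nbhs (0 : X) V -> (forall x, V x -> V (- x)) ->
  forall x, exists2 l : seq X, (forall y, y \in l -> V y) & x = \sum_(y <- l) y.
Proof.
move=> V0 VN; have [S SE] : exists S : zmodClosed X, [set` S] =
    [set x | exists2 l : seq X, (forall y, y \in l -> V y) & x = \sum_(y <- l) y].
  apply: zmodClosed_of; first by exists [::]; rewrite ?big_nil.
  move=> _ _ [l lV ->] [l' lV' ->]; exists (l ++ map -%R l').
    move=> y; rewrite mem_cat => /orP [/lV //|/mapP [z /lV' Vz ->]]; exact: VN.
  by rewrite big_cat /= big_map sumrN.
have oS : open [set` S].
  apply: (sub_nbhs_open _ _ V0); rewrite SE => x Vx; exists [:: x]; rewrite ?big_seq1 //.
  by move=> y; rewrite inE => /eqP ->.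
move=> x; have := connected_open_subgroup S connX oS x.
by change ([set` S] x -> exists2 l : seq X, (forall y, y \in l -> V y) & x = \sum_(y <- l) y);
  rewrite SE.
Qed.

(** Finitely many small elements generate a finite group [H] that comes close
    to every point, an image of a vector space over ['F_p]. A neighbourhood of
    [0] has density bounded below in [H] independently of the generators, so
    Bogoliubov's theorem puts a subgroup of bounded index of [H] near [0]; as
    the generators are as small as desired, [H] cannot get far from it. *)
Lemma connected_compact_exponent p : prime p -> (forall x : X, x *+ p = 0) ->
  forall W, nbhs (0 : X) W -> forall x, W x.
Proof.
move=> p_pr Xp W W0.
have [W1 [W10 W1N W1W]] := nbhs0_sums 3 _ W0.
have [V [V0 VN VW1]] := nbhs0_sums 4 _ W10.
have [s sX] := compact_translates _ _ cX V0.
pose k := size s.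
have [V' [V'0 V'N V'W1]] := nbhs0_sums (k ^ 2 * p) _ W10.
pose V2 := V' `&` W1.
have V20 : nbhs (0 : X) V2 by exact: filterI.
have V2N x : V2 x -> V2 (- x) by move=> [? ?]; split; [exact: V'N|exact: W1N].
have [t tX] := compact_translates _ _ cX V20.
have /choice [gen genP] : forall x, exists l : seq X,
    (forall y, y \in l -> V2 y) /\ x = \sum_(y <- l) y.
  by move=> x; have [l h1 h2] := connected_generated _ V20 V2N x; exists l.
pose vs := flatten (map gen t).
pose n := size vs.
pose v (i : 'I_n) := vs`_i.
have vV i : V2 (v i).
  have : v i \in vs by exact: mem_nth.
  by move=> /flattenP [_ /mapP [y yt ->]] /(proj1 (genP y)).
pose sg : 'rV['F_p]_n -> X := Fp_comb v.
have sgD := Fp_combD p_pr Xp v : {morph sg : x y / x + y}.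
have sgB := Fp_combB p_pr Xp v : {morph sg : x y / x - y}.
have sg_t y : y \in t -> exists z, sg z = y.
  move=> yt; rewrite (proj2 (genP y)).
  have : {subset gen y <= vs}.
    by move=> x xy; apply/flattenP; exists (gen y) => //; exact: map_f.
  elim: (gen y) => [_|a l IH sub].
    exists 0; rewrite big_nil; apply: (addIr (sg 0)); by rewrite -sgD !add0r.
  have [z zE] := IH (fun x xl => sub x (mem_behead (s := a :: l) xl)).
  have avs : (index a vs < n)%N by rewrite index_mem; exact: sub (mem_head _ _).
  exists (delta_mx 0 (Ordinal avs) + z); rewrite big_cons sgD zE; congr (_ + _).
  by rewrite -[delta_mx _ _]scale1r /sg Fp_comb_delta /v nth_index ?sub ?mem_head.
(* a translate of V of density at least 1 / k *)
pose E (j : 'I_k) := [set z : 'rV['F_p]_n | `[< V (sg z - s`_j) >]]%SET.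
have [j Ej] : exists j, (#|{: 'rV['F_p]_n}| <= k * #|E j|)%N.
  apply: contrapT => /forallNP nE.
  have cover z : exists j, z \in E j.
    have [y ys Vy] := sX (sg z) I; rewrite -index_mem in ys.
    by exists (Ordinal ys); rewrite inE; apply/asboolP; rewrite /= nth_index // -index_mem.
  have k0 : (0 < k)%N by have [j0 _] := cover 0; exact: leq_ltn_trans (ltn_ord j0).
  have total : (#|{: 'rV['F_p]_n}| <= \sum_j #|E j|)%N.
    rewrite -sum1_card (eq_bigr (fun j => \sum_z (z \in E j : nat))%N); last first.
      by move=> j _; rewrite -sum1_card big_mkcond.
    rewrite exchange_big /=; apply: leq_sum => z _; have [j zj] := cover z.
    by rewrite (bigD1 j) //= zj leq_addr.
  have : (\sum_(j < k) (k * #|E j|).+1 <= \sum_(j < k) #|{: 'rV['F_p]_n}|)%N.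
    by apply: leq_sum => j _; rewrite ltnNge; apply/negP; exact: nE.
  rewrite sum_nat_const card_ord.
  under eq_bigr => j _ do rewrite -addn1.
  rewrite big_split /= sum_nat_const card_ord muln1 -big_distrr /=.
  rewrite -(leq_pmul2l k0) in total => /leq_trans /(_ total).
  by rewrite -[leqRHS]addn0 leq_add2l leqNgt k0.
have Ej0 : (0 < #|E j|)%N.
  rewrite lt0n; apply/eqP => E0; move: Ej; rewrite E0 muln0 leqn0 => /eqP.
  by rewrite (cardD1 (0 : 'rV['F_p]_n)).
have [w w_pr] := C_prim_root_exists (prime_gt0 p_pr).
have [K [Kk hK]] := bogoliubov _ _ _ p_pr w_pr _ _ Ej0 Ej.
pose M : 'M['F_p]_(n, #|K|) := \matrix_(i < n, l < #|K|) (@enum_val _ (mem K) l : 'rV['F_p]_n) 0 i.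
have [r [f [rK hf]]] := mod_annihilator _ _ _ M.
have small z : exists2 y, W1 y & W1 (sg z - y).
  have [y yM] := hf z; exists (sg (\sum_l y l *: delta_mx 0 (f l))).
    rewrite /sg Fp_comb_sum //.
    pose l := flatten [seq nseq (y i : nat) (v (f i)) | i <- enum 'I_r].
    have -> : \sum_i v (f i) *+ (y i : nat) = \sum_(x <- l) x.
      rewrite big_flatten big_map big_enum; apply: eq_bigr => i _.
      by rewrite big_nseq -Monoid.iteropE; elim: (y i : nat) => // ? ?; rewrite mulrS.
    apply: V'W1; last first.
      by move=> x /flattenP [_ /mapP [i _ ->]] /nseqP [-> _]; case: (vV (f i)).
    rewrite size_flatten /shape -map_comp sumnE big_map big_enum /=.
    apply: (@leq_trans (\sum_(i < r) p)).
      apply: leq_sum => i _; rewrite size_nseq; have := ltn_ord (y i).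
      by rewrite [X in (_ < X)%N](Fp_cast p_pr) => /ltnW.
    by rewrite sum_nat_const card_ord leq_mul2r (leq_trans rK Kk) orbT.
  rewrite -sgB; set z' := z - _ in yM *.
  have [|x1 [x2 [x3 [x4 [[]]]]]] := hK z'.
    move=> a aK; have := congr1 (fun A : 'rV_#|K| => A 0 (enum_rank_in aK a)) yM.
    rewrite !mxE => <-; apply: eq_bigr => i _.
    by rewrite !mxE enum_rankK_in // mulrC.
  rewrite !inE => /asboolP/asboolP h1 /asboolP/asboolP h2 /asboolP/asboolP h3 /asboolP/asboolP h4 ->.
  rewrite sgB !sgD.
  rewrite (_ : _ - _ = \sum_(q <- [:: sg x1 - s`_j; sg x2 - s`_j;
    - (sg x3 - s`_j); - (sg x4 - s`_j)]) q).
    by apply: VW1 => // q; rewrite !inE => /or4P [] /eqP -> //; exact: VN.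
  by rewrite !big_cons big_nil; zmod.
move=> x; have [y yt [_ xy]] := tX x I; have [z zy] := sg_t y yt.
have [a W1a W1za] := small z.
rewrite (_ : x = \sum_(q <- [:: x - y; a; sg z - a]) q).
  by apply: W1W => // q; rewrite !inE => /or3P [] /eqP ->.
by rewrite !big_cons big_nil zy; zmod.
Qed.
End Connected.

(** For prime [p], the quotient by [p X] is connected, compact and killed by
    [p]. *)
Lemma connected_compact_divisible {X : topologicalZmodType} :
  hausdorff_space X -> compact [set: X] -> connected [set: X] ->
  forall n (x : X), (0 < n)%N -> exists y, x = y *+ n.
Proof.
move=> hX cX connX.
have prime_div p (x : X) : prime p -> exists y, x = y *+ p.
  move=> p_pr; have [S SE] : exists S : zmodClosed X, [set` S] = [set y *+ p | y in [set: X]].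
    apply: zmodClosed_of; first by exists 0; rewrite ?mul0rn.
    by move=> _ _ [a _ <-] [b _ <-]; exists (a - b); rewrite ?mulrnBl.
  have SP y : y \in S <-> exists z, y = z *+ p.
    change ([set` S] y <-> exists z, y = z *+ p); rewrite SE.
    by split=> [[z _ <-]|[z ->]]; exists z.
  have clS : closed [set` S] by rewrite SE; apply: compact_closed => //; exact: compact_muln.
  have quoT : quo S @` [set: X] = [set: quotient_group S].
    by apply/seteqP; split=> // q _; have [y <-] := quo_surj S q; exists y.
  have cY : compact [set: quotient_group S] by rewrite -quoT; exact: quo_compact.
  have connY : connected [set: quotient_group S].
    rewrite -quoT; apply: connected_continuous_connected => //.
    by apply: continuous_subspaceT; exact: quo_continuous.
  apply/SP/quo_eq0/(hausdorff_nbhs0 _ (quotient_hausdorff S clS)) => W W0.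
  apply: (connected_compact_exponent cY connY _ p_pr _ _ W0) => q.
  have [y <-] := quo_surj S q; rewrite -raddfMn; apply/quo_eq0/SP; by exists y.
move=> n; elim/ltn_ind: n => n IH x n0.
have [n1|n1] := leqP n 1; first by exists x; have -> : n = 1%N by lia.
have [y xy] := prime_div (pdiv n) x (pdiv_prime n1).
have [||z yz] := IH (n %/ pdiv n)%N _ y.
- by rewrite ltn_Pdiv // prime_gt1 // pdiv_prime.
- by rewrite divn_gt0 ?pdiv_gt0 // pdiv_leq.
by exists z; rewrite xy yz -mulrnA divnK // pdiv_dvd.
Qed.

(** * Homomorphisms between groups of different types *)

(** Pointwise convergence of [n! g] to [0] is locally uniform somewhere, by a
    Baire argument, hence uniform on the compact group [X]; but [n! X = X]. *)
Lemma hom_to_topological_torsion {X T : topologicalZmodType} (g : {additive X -> T}) :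
  compact [set: X] -> (forall n (x : X), (0 < n)%N -> exists y, x = y *+ n) ->
  topological_torsion T -> continuous g -> forall x, g x = 0.
Proof.
move=> cX divX [lcT torsT] cg x0; apply: (hausdorff_nbhs0 _ lcT.1) => W W0.
have [W1 [W10 W1N W1W]] := nbhs0_sums 3 _ W0.
have [Wc [Wc0 clWc WcW1]] := closed_subnbhs _ W10.
pose bad n := [set x | ~ Wc (g x *+ n`!)].
have open_bad n : open (bad n).
  apply: (@open_comp _ _ (fun x => g x *+ n`!) (~` Wc)); last exact: closed_openC.
  move=> x _; apply: (@continuous_comp _ _ _ g (fun y => y *+ n`!)); first exact: cg.
  exact: mulrn_continuous.
have [[N [z [V [V0 hV]]]]|nex] := pselect (exists N z V, nbhs (0 : X) V /\
    forall n v, (N <= n)%N -> V v -> Wc (g (z + v) *+ n`!)).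
  have [t tX] := compact_translates _ _ cX V0.
  have [n1 n1t] : exists n1, forall n, (n1 <= n)%N -> forall y, y \in t -> Wc (g y *+ n`!).
    elim: {tX} t => [|y t [n1 n1t]]; first by exists 0%N.
    have [n2 _ n2y] := torsT (g y) _ Wc0; exists (maxn n1 n2) => n.
    rewrite geq_max => /andP [n1n n2n] y'; rewrite inE => /orP [/eqP ->|]; first exact: n2y.
    exact: n1t.
  pose n := maxn N n1.
  have nN : (N <= n)%N by exact: leq_maxl.
  have nt := n1t n (leq_maxr _ _).
  have [x xE] := divX n`! x0 (fact_gt0 n); have [y yt Vxy] := tX x I.
  rewrite (_ : g x0 = \sum_(q <- [:: g y *+ n`!; g (z + (x - y)) *+ n`!; - (g (z + 0) *+ n`!)]) q).
    apply: W1W => // q; rewrite !inE => /or3P [] /eqP ->.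
    - by apply/WcW1/nt.
    - by apply/WcW1/hV.
    - by apply/W1N/WcW1/hV => //; exact: nbhs_singleton.
  rewrite xE !big_cons big_nil !raddfD raddfN raddf0 raddfMn !mulrnDl mulNrn mul0rn.
  zmod.
exfalso.
(* nested closed sets on which g x *+ n! leaves Wc for larger and larger n *)
pose good (B : set X) := closed B /\ exists z : X, nbhs z B.
have step (q : set X * nat) : exists r : set X * nat, good q.1 ->
    [/\ (q.2 < r.2)%N, r.1 `<=` q.1, good r.1 & r.1 `<=` bad r.2].
  case: q => B N /=.
  have [[clB [z zB]]|nB] := pselect (good B); last by exists (B, N).
  have V0 : nbhs (0 : X) [set v | B° (z + v)].
    by apply/(nbhs_shift z B°); exact: nbhs_interior.
  have [n [v [Nn Vv nWc]]] : exists n v, [/\ (N < n)%N, B° (z + v) & bad n (z + v)].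
    apply: contrapT => nn; apply: nex; exists N.+1, z, [set v | B° (z + v)]; split=> // n v Nn Vv.
    by apply: contrapT => nW; apply: nn; exists n, v.
  have nb : nbhs (z + v) (B `&` bad n).
    by apply: filterI => //; move: (open_bad n); rewrite openE; apply.
  have /nbhs_shift /closed_subnbhs [D [D0 clD DB]] := nb.
  exists ([set x | D (- (z + v) + x)], n) => _ /=; split=> //.
  - by move=> x /DB /=; rewrite addrA subrr add0r => -[].
  - split.
      apply: (@closed_comp _ _ (fun x => - (z + v) + x) D) => // y _; exact: shift_continuous.
    exists (z + v); apply/nbhs_shift; apply: filterS D0 => y /=.
    by rewrite addrA addNr add0r.
  - by move=> x /DB /=; rewrite addrA subrr add0r => -[].
have /choice [nxt nxtP] := step.
pose q j := iter j nxt (setT, 0%N).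
have q0 : good (q 0%N).1 by split; [exact: closedT|exists 0; exact: filterT].
have qgood j : good (q j).1.
  by elim: j => // j IH; have [] := nxtP _ IH.
have qS j := nxtP (q j) (qgood j).
have [||||x xq] := nested_compact cX (C := fun j => (q j).1).
- by move=> j; case: (qgood j).
- by move=> j; case: (qS j).
- by move=> j; have [_ [z /nbhs_singleton]] := qgood j; exists z.
- by [].
have qn j : (j <= (q j).2)%N.
  by elim: j => // j IH; have [h _ _ _] := qS j; exact: leq_ltn_trans IH h.
have [N _ hN] := torsT (g x) _ Wc0.
have [_ _ _ bq] := qS N.
apply: (bq x (xq N.+1)); apply: hN => /=; exact: leq_trans (leqnSn N) (qn N.+1).
Qed.

(** The image is bounded and stable under multiples. *)
Lemma hom_to_real_trivial {R : realType} {k : nat} {X : topologicalZmodType}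
    (h : {additive X -> 'rV[R]_k}) :
  compact [set: X] -> continuous h -> forall x, h x = 0.
Proof.
move=> cX ch x.
have : compact (h @` [set: X]).
  by apply: continuous_compact => //; exact: continuous_subspaceT.
move=> /compact_bounded [M [_ hM]].
apply/eqP; rewrite -normr_eq0 eq_le normr_ge0 andbT; apply/ler_addgt0Pr => e e0.
rewrite add0r leNgt; apply/negP => eh.
pose n := (Num.bound ((`|M| + 1) / `|h x|)).+1.
have hx0 : 0 < `|h x| by exact: lt_trans eh.
have : `|h (x *+ n)| <= `|M| + 1.
  by apply: hM; [rewrite (le_lt_trans (ler_norm M)) // ltrDl|exists (x *+ n)].
rewrite raddfMn normrMn -mulr_natl -ler_pdivlMr // leNgt => /negP; apply.
apply: lt_trans (archi_boundP _) _; first by rewrite divr_ge0 // addr_ge0.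
by rewrite ltr_nat.
Qed.

Lemma hom_to_discrete_trivial {X B : topologicalZmodType} (h : {additive X -> B}) :
  connected [set: X] -> discrete B -> continuous h -> forall x, h x = 0.
Proof.
move=> connX dB ch; have [S SE] : exists S : zmodClosed X, [set` S] = [set x | h x = 0].
  apply: zmodClosed_of; first exact: raddf0.
  by move=> x y /= hx hy; rewrite raddfB hx hy subrr.
have oS : open [set` S].
  rewrite SE; apply: (@open_comp _ _ h [set 0]); last exact: dB.
  by move=> x _; exact: ch.
move=> x; have := connected_open_subgroup S connX oS x.
by change ([set` S] x -> h x = 0); rewrite SE.
Qed.

Section TypeA.
Context {R : realType} {E : topologicalZmodType} (tE : type_A R E).

Lemma hom_to_type_A {X : topologicalZmodType} (g : {additive X -> E}) :
  hausdorff_space X -> compact [set: X] -> connected [set: X] -> continuous g ->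
  forall x, g x = 0.
Proof.
move=> hX cX connX cg.
have [_ [GR [Gtt [[k [u [u' [uK _ cu _]]]] ttG [f [f' [fK _ cf _]]]]]]] := tE.
have [h1 h1E] : exists h : {additive X -> 'rV[R]_k},
    (h : X -> 'rV[R]_k) = (fun x => u (f (g x)).1).
  by apply: additive_of => x y; rewrite !raddfB.
have [h2 h2E] : exists h : {additive X -> Gtt}, (h : X -> Gtt) = (fun x => (f (g x)).2).
  by apply: additive_of => x y; rewrite !raddfB.
have cfg : continuous (f \o g : X -> GR * Gtt).
  by move=> x; apply: (@continuous_comp _ _ _ g f); [exact: cg|exact: cf].
have ch1 : continuous h1.
  rewrite h1E => x; apply: (@continuous_comp _ _ _ (fst \o (f \o g)) u); last exact: cu.
  by apply: (@continuous_comp _ _ _ (f \o g : X -> GR * Gtt) fst); [exact: cfg|exact: cvg_fst].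
have ch2 : continuous h2.
  rewrite h2E => x.
  by apply: (@continuous_comp _ _ _ (f \o g : X -> GR * Gtt) snd); [exact: cfg|exact: cvg_snd].
move=> x; apply: (can_inj fK); rewrite raddf0.
have := hom_to_real_trivial h1 cX ch1 x; rewrite h1E => e1.
have e2 := hom_to_topological_torsion h2 cX (connected_compact_divisible hX cX connX) ttG ch2 x.
rewrite h2E in e2.
have e3 : (f (g x)).1 = 0 by apply: (can_inj uK); rewrite e1 raddf0.
by case: (f (g x)) e2 e3 => a b /= -> ->.
Qed.

(** On the real factor the kernel contains a ball, hence everything. On the
    torsion factor [n!] times the image of an element vanishes for large [n],
    because [Z] is discrete. *)
Lemma hom_from_type_A {Z : topologicalZmodType} (g : {additive E -> Z}) :
  type_Z Z -> continuous g -> forall x, g x = 0.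
Proof.
move=> [lcZ dZ tfZ] cg.
have [_ [GR [Gtt [[k [u [u' [uK u'K cu cu']]]] [_ ttG] [f [f' [fK f'K cf cf']]]]]]] := tE.
have f'B : {morph f' : x y / x - y}.
  by move=> x y; apply: (can_inj fK); rewrite raddfB !f'K.
have u'B : {morph u' : x y / x - y}.
  by move=> x y; apply: (can_inj uK); rewrite raddfB !u'K.
have [h1 h1E] : exists h : {additive 'rV[R]_k -> Z},
    (h : 'rV[R]_k -> Z) = (fun v => g (f' (u' v, 0))).
  apply: additive_of => x y; rewrite -raddfB -f'B u'B; congr (g (f' _)).
  by rewrite -[RHS]/(_, _) /= subr0.
have [h2 h2E] : exists h : {additive Gtt -> Z}, (h : Gtt -> Z) = (fun t => g (f' (0, t))).
  apply: additive_of => x y; rewrite -raddfB -f'B; congr (g (f' _)).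
  by rewrite -[RHS]/(_, _) /= subr0.
have cgf' : continuous (g \o f' : GR * Gtt -> Z).
  by move=> x; apply: (@continuous_comp _ _ _ f' g); [exact: cf'|exact: cg].
have ch1 : continuous h1.
  rewrite h1E => v; apply: (@continuous_comp _ _ _ (fun v => (u' v, 0 : Gtt))
    (g \o f' : GR * Gtt -> Z)); last exact: cgf'.
  exact: (pair_continuous cu' (@cst_continuous 'rV[R]_k Gtt 0)).
have ch2 : continuous h2.
  rewrite h2E => v; apply: (@continuous_comp _ _ _ (fun v => (0 : GR, v))
    (g \o f' : GR * Gtt -> Z)); last exact: cgf'.
  exact: (pair_continuous (@cst_continuous Gtt GR 0) id_continuous).
have Z0 : nbhs (0 : Z) [set 0] by have := dZ [set 0]; rewrite openE; apply.
have h10 v : h1 v = 0.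
  have : nbhs (0 : 'rV[R]_k) (h1 @^-1` [set 0]) by apply: ch1; rewrite raddf0.
  move=> /nbhs_ballP [e /= e0 he].
  pose n := (Num.bound (`|v| / e)).+1.
  have n0 : 0 < n%:R :> R by rewrite ltr0n.
  have -> : v = (n%:R^-1 *: v) *+ n by rewrite -scaler_nat scalerA mulfV ?scale1r // gt_eqF.
  rewrite raddfMn (_ : h1 _ = 0) ?mul0rn //; apply: he.
  rewrite -ball_normE /= sub0r normrN normrZ ger0_norm ?invr_ge0 ?ltW //.
  rewrite mulrC ltr_pdivrMr // mulrC -ltr_pdivrMr //.
  apply: lt_trans (archi_boundP _) _; first by rewrite divr_ge0 // ltW.
  by rewrite ltr_nat.
have h20 t : h2 t = 0.
  have : nbhs (0 : Gtt) (h2 @^-1` [set 0]) by apply: ch2; rewrite raddf0.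
  move=> /(ttG t) [n _ /(_ n (leqnn n))] /=; rewrite raddfMn.
  by apply: tfZ; exact: fact_gt0.
move=> x; rewrite -(fK x); case: (f x) => r t.
have -> : f' (r, t) = f' (r, 0) - f' (0, - t).
  by rewrite -f'B; congr f'; rewrite -[RHS]/(_, _) /= subr0 sub0r opprK.
rewrite raddfB; have := h10 (u r); rewrite h1E uK => ->.
by have := h20 (- t); rewrite h2E => ->; rewrite subrr.
Qed.
End TypeA.

(** * Functoriality and uniqueness *)

Section Functoriality.
Context {R : realType} {A B : topologicalZmodType} (f : {additive A -> B}).
Context {SA FA : zmodClosed A} {SB FB : zmodClosed B}.
Hypotheses (cf : continuous f).
Hypotheses (chA : is_canonical_chain R SA FA) (chB : is_canonical_chain R SB FB).

(** The image of a compact connected group dies in the type Z quotient of [B],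
    then in its type A subquotient. *)
Lemma canonical_chain_hom_S1 : {subset SA <= [pred x | f x \in SB]}.
Proof.
have [_ _ [[hX _] cX connX] _ _] := chA; have [_ _ _ tEB [_ dB _]] := chB.
have cfv : continuous (f \o val : subgroup SA -> B).
  move=> x; apply: (@continuous_comp _ _ _ (val : subgroup SA -> A) f); last exact: cf.
  exact: subgroup_val_continuous.
have fvB (x y : subgroup SA) : f (val (x - y)) = f (val x) - f (val y) by rewrite -raddfB.
have [h1 h1E] : exists h : {additive subgroup SA -> quotient_group FB},
    (h : subgroup SA -> quotient_group FB) = (fun x => quo FB (f (val x))).
  by apply: additive_of => x y; rewrite fvB raddfB.
have ch1 : continuous h1.
  rewrite h1E => x; apply: (@continuous_comp _ _ _ (f \o val : subgroup SA -> B) (quo FB)).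
    exact: cfv.
  exact: quo_continuous.
have FBf (x : subgroup SA) : f (val x) \in FB.
  by apply/quo_eq0; have := hom_to_discrete_trivial h1 connX dB ch1 x; rewrite h1E.
pose l x : subgroup FB := Sub (f (val x)) (FBf x).
have cl : continuous l by apply: continuous_comp_initial; exact: cfv.
have lB x y : l (x - y) = l x - l y by apply: val_inj; exact: fvB.
have [h2 h2E] : exists h : {additive subgroup SA -> subquotient FB SB},
    (h : subgroup SA -> subquotient FB SB) = (fun x => quo (subgroup_in FB SB) (l x)).
  by apply: additive_of => x y; rewrite lB raddfB.
have ch2 : continuous h2.
  rewrite h2E => x; apply: (@continuous_comp _ _ _ l (quo (subgroup_in FB SB))).
    exact: cl.
  exact: quo_continuous.
move=> x SAx; have := hom_to_type_A tEB h2 hX cX connX ch2 (Sub x SAx).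
by rewrite h2E => /quo_eq0.
Qed.

(** A homomorphism from a group of type A to a group of type Z is zero. *)
Lemma canonical_chain_hom_FZ : {subset FA <= [pred x | f x \in FB]}.
Proof.
have [_ _ _ tEA _] := chA; have [_ SFB _ _ tZ] := chB.
have [h hE] : exists h : {additive subgroup FA -> quotient_group FB},
    (h : subgroup FA -> quotient_group FB) = (fun x => quo FB (f (val x))).
  by apply: additive_of => x y; rewrite -!raddfB.
have ch : continuous h.
  rewrite hE => x; apply: (@continuous_comp _ _ _ (f \o val : subgroup FA -> B) (quo FB)).
    apply: (@continuous_comp _ _ _ (val : subgroup FA -> A) f); last exact: cf.
    exact: subgroup_val_continuous.
  exact: quo_continuous.
have [|g cg gE] := quotient_factor (subgroup_in FA SA) h ch.
  by move=> x SAx; rewrite hE; apply/quo_eq0/SFB; exact: canonical_chain_hom_S1.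
move=> x FAx; have := gE (Sub x FAx).
by rewrite (hom_from_type_A tEA g tZ cg) hE => /esym /quo_eq0.
Qed.

Lemma canonical_chain_hom :
  f @` [set` SA] `<=` [set` SB] /\ f @` [set` FA] `<=` [set` FB].
Proof.
split=> _ [x hx <-]; [exact: canonical_chain_hom_S1|exact: canonical_chain_hom_FZ].
Qed.
End Functoriality.

Theorem proposition2p2 (R : realType) :
  (forall A : topologicalZmodType, LCA A ->
     exists! SF : zmodClosed A * zmodClosed A,
       is_canonical_chain R SF.1 SF.2) /\
  (forall (A B : topologicalZmodType) (f : {additive A -> B}),
     LCA A -> LCA B -> continuous f ->
     forall (SA FA : zmodClosed A) (SB FB : zmodClosed B),
       is_canonical_chain R SA FA -> is_canonical_chain R SB FB ->
       f @` [set` SA] `<=` [set` SB] /\ f @` [set` FA] `<=` [set` FB]).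
Proof.
split=> [A lcA|A B f _ _ cf SA FA SB FB chA chB]; last exact: (canonical_chain_hom f cf chA chB).
have [[S F] chSF] := canonical_chain_exists R A lcA.
exists (S, F); split=> // -[S' F'] chSF'.
have cid : continuous (idfun : A -> A) by exact: id_continuous.
have [SS' FF'] := canonical_chain_hom idfun cid chSF chSF'.
have [S'S F'F] := canonical_chain_hom idfun cid chSF' chSF.
congr pair; apply: zmodClosed_inj; apply/seteqP; split=> x hx.
- by apply: SS'; exists x.
- by apply: S'S; exists x.
- by apply: FF'; exists x.
- by apply: F'F; exists x.
Qed.
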